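(* Let $\lambda$ and $\mu$ be partitions with $\mu\subset\lambda$, put $\delta=\lambda/\mu$, and let ${\pmb k}\in I_{\delta}^{\mathrm D}$. Let ${\pmb k}^{\dagger}$ be the dual tableau of ${\pmb k}$ and let $\delta^{\dagger}$ be the (skew) shape of ${\pmb k}^{\dagger}$. Then $$\zeta_{\delta}({\pmb k})=\zeta_{\delta^{\dagger}}({\pmb k}^{\dagger}).$$
   Context: **Tableaux and Schur multiple zeta values.** Rows are numbered from top to bottom and columns from left to right. For partitions $\mu\subset\lambda$ (i.e. $\mu_i\le\lambda_i$ for all $i$), the skew Young diagram $\delta=\lambda/\mu$ is the set of boxes $(i,j)$ of $\lambda$ not in $\mu$ ($\mu=\emptyset$ is allowed). $T_\delta(X)$ is the set of all fillings of $\delta$ by elements of $X$. $\mathrm{SSYT}_\delta\subset T_\delta(\mathbb{N})$, with $\mathbb N=\{1,2,\dots\}$, is the set of semi-standard tableaux $M=(m_{ij})$: entries weakly increase from left to right along rows and strictly increase from top to bottom down columns. For ${\pmb s}=(s_{ij})\in T_\delta(\mathbb{C})$, $$\zeta_\delta({\pmb s})=\sum_{M\in \mathrm{SSYT}_\delta}\ \prod_{(i,j)\in\delta} m_{ij}^{-s_{ij}},$$ which converges absolutely if $\Re(s_{ij})\ge 1$ for all boxes and $\Re(s_{ij})>1$ for all corners of $\delta$ (boxes $(i,j)\in\delta$ with $(i+1,j)\notin\delta$ and $(i,j+1)\notin\delta$). **Admissible pieces.** For integers $a,b\ge 1$, the admissible piece $A(a,b)$ is the finite sequence $\underbrace{1,\dots,1}_{a-1},b+1$,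 and its dual is $A(a,b)^\dagger:=A(b,a)$. A sequence of positive integers whose last term is $\ge 2$ (an admissible index) is uniquely a concatenation of admissible pieces $(A_1,\dots,A_m)$; its dual index is $(A_m^\dagger,\dots,A_1^\dagger)$. **The set $I_\delta^{\mathrm D}$.** Let $T_\delta^{\mathrm{diag}}(\mathbb{Z})$ be the set of ${\pmb s}\in T_\delta(\mathbb{Z})$ with $s_{ij}=s_{pq}$ whenever $j-i=q-p$. Then $I_\delta^{\mathrm D}$ is the set of ${\pmb k}=(k_{ij})\in T_\delta^{\mathrm{diag}}(\mathbb{Z})$ such that (1) each non-empty column, read from top to bottom, is a concatenation of admissible pieces (i.e. is an admissible index); and (2) whenever $(r,j)$ is the top box of column $j$ and $(r,j+1)\in\delta$, one has $k_{r,j+1}\neq 1$. **Indexing of pieces.** Let ${\pmb k}\in I_\delta^{\mathrm D}$. Decompose every column into admissible pieces. The pieces of column $j$, from top to bottom, are labelled $A_{nj},A_{(n+1)j},\dots,A_{(n+m)j}$ with consecutive first indices, the topmost level of pieces being numbered $1$, in such a way that the top box of $A_{ij}$ and the bottom box of $A_{i(j+1)}$ lie in the same row, side by side, whenever both pieces are non-empty. (If columns $j$ and $j+1$ share no row, all first indices of pieces in column $j$ are larger than those in column $j+1$.) **The dual tableau.** The dual of column $j$ with pieces $A_{nj},\dots,A_{(n+m)j}$ (top to bottom) is the column with pieces $A_{(n+m)j}^\dagger,\dots,A_{nj}^\dagger$ (top to bottom). The dual tableau ${\pmb k}^\dagger$ is obtained by arranging the dual columns in the reversed order, from left to right: the dual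 of column $\lambda_1$, the dual of column $\lambda_1-1$, ..., the dual of column $1$, where for $2\le j\le\lambda_1$ the top box of $A_{ij}^\dagger$ and the bottom box of $A_{i(j-1)}^\dagger$ are put side by side (in the same row) whenever both are non-empty. If columns $j$ and $j-1$ of ${\pmb k}$ have no common first index $i$, the dual of column $j-1$ is placed in rows strictly above those of the dual of column $j$ (the exact offset does not affect the value of $\zeta_{\delta^\dagger}$). The shape $\delta^\dagger$ of ${\pmb k}^\dagger$ is a skew Young diagram. *)

(* Defs.v *)
From mathcomp Require Import all_boot all_order all_algebra finmap.
From mathcomp Require Import boolp classical_sets reals ereal esum.

Set Implicit Arguments.
Unset Strict Implicit.
Unset Printing Implicit Defensive.

Import Order.TTheory GRing.Theory Num.Theory.
Local Open Scope fset_scope.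
Local Open Scope ring_scope.

(* Rows, columns and boxes are numbered from 0: the box (i, j) of the text is
   (i.-1, j.-1) here, and the columns of la / mu are 0, ..., head 0 la - 1. *)

Definition is_partition (la : seq nat) : bool :=
  sorted geq la && (0%N \notin la).

Definition skew_pair (la mu : seq nat) : Prop :=
  [/\ is_partition la, is_partition mu
    & forall i, (nth 0 mu i <= nth 0 la i)%N].

Definition skew_diagram (la mu : seq nat) : {fset nat * nat} :=
  [fset x in [seq (i, j) | i <- iota 0 (size la), j <- iota 0 (nth 0%N la i)]
     | nth 0 mu x.1 <= x.2]%N.

Definition filling (D : {fset nat * nat}) (X : Type) := {ffun D -> X}.

Definition row_of (D : {fset nat * nat}) (x : D) : nat := (val x).1.
Definition col_of (D : {fset nat * nat}) (x : D) : nat := (val x).2.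

(** Schur multiple zeta values *)

Definition ssyt (D : {fset nat * nat}) (M : filling D nat) : Prop :=
  [/\ forall x, (0 < M x)%N,
      forall x y, row_of x = row_of y -> (col_of x < col_of y)%N ->
        (M x <= M y)%N
    & forall x y, col_of x = col_of y -> (row_of x < row_of y)%N ->
        (M x < M y)%N].

(* The exponents are integers, so every term is a positive real number; the
   value is +oo exactly when the series diverges. *)
Definition schur_zeta (R : realType) (D : {fset nat * nat})
    (s : filling D int) : \bar R :=
  \esum_(M in [set M : {ffun D -> nat} | ssyt M])
    (\prod_(x : D) (M x)%:R ^ (- s x))%:E.

(** Admissible pieces *)

(* The pair (a, b) stands for the piece A(a, b). *)
Definition piece (p : nat * nat) : seq int := rcons (nseq p.1.-1 1) p.2.+1%:Z.

Definition dual_piece (p : nat * nat) : nat * nat := (p.2, p.1).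

Definition pieces_of (w : seq int) (ps : seq (nat * nat)) : Prop :=
  all (fun p => (0 < p.1) && (0 < p.2))%N ps
  /\ w = flatten [seq piece p | p <- ps].

Definition dual_pieces (ps : seq (nat * nat)) : seq (nat * nat) :=
  [seq dual_piece p | p <- rev ps].

(** Columns, read from top to bottom *)

Definition col_rows (la mu : seq nat) (j : nat) : seq nat :=
  [seq i <- iota 0 (size la) | (i, j) \in skew_diagram la mu].

Definition col_word (la mu : seq nat) (k : filling (skew_diagram la mu) int)
    (j : nat) : seq int :=
  pmap (fun i => omap k (insub (i, j))) (iota 0 (size la)).

(* The rows of the top and bottom boxes of the p-th piece (from 0) of a column
   that occupies the rows rs and has pieces ps; A(a, b) has a boxes. *)
Definition piece_rows (rs : seq nat) (ps : seq (nat * nat)) (p : nat) :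
    seq nat :=
  nth [::] (reshape [seq a.1 | a <- ps] rs) p.

Definition top_row rs ps p : nat := head 0%N (piece_rows rs ps p).
Definition bot_row rs ps p : nat := last 0%N (piece_rows rs ps p).

(* Equals j' = j.+1 unless empty columns lie between columns j and j'. *)
Definition next_col (la mu : seq nat) (j j' : nat) : Prop :=
  [/\ (j < j')%N, col_rows la mu j != [::], col_rows la mu j' != [::]
    & forall c, (j < c < j')%N -> col_rows la mu c = [::]].

(** The set I^D *)

Definition diag_const (D : {fset nat * nat}) (s : filling D int) : Prop :=
  forall x y : D,
    (col_of x)%:Z - (row_of x)%:Z = (col_of y)%:Z - (row_of y)%:Z -> s x = s y.

Definition top_box (D : {fset nat * nat}) (x : D) : Prop :=
  forall z : D, col_of z = col_of x -> (row_of x <= row_of z)%N.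

Definition in_ID (la mu : seq nat) (k : filling (skew_diagram la mu) int) : Prop :=
  [/\ diag_const k,
      forall j, col_rows la mu j != [::] -> exists ps, pieces_of (col_word k j) ps
    & forall x y : skew_diagram la mu, top_box x ->
        row_of y = row_of x -> col_of y = (col_of x).+1 -> k y <> 1].

(** Indexing of pieces *)

(* The p-th piece (from 0) of P j has first index n j + p.  The third clause is
   an equivalence because two adjacent columns that share a row must be given a
   common first index. *)
Definition labelling (la mu : seq nat) (P : nat -> seq (nat * nat))
    (n : nat -> nat) : Prop :=
  [/\ forall j, col_rows la mu j != [::] -> (1 <= n j)%N,
      skew_diagram la mu != fset0 -> exists2 j, col_rows la mu j != [::] & n j = 1%N,
      forall j p q, (p < size (P j))%N -> (q < size (P j.+1))%N ->
        (n j + p = n j.+1 + q)%N <->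
        top_row (col_rows la mu j) (P j) p
          = bot_row (col_rows la mu j.+1) (P j.+1) q
    & forall j j', next_col la mu j j' ->
        (forall r, r \in col_rows la mu j -> r \notin col_rows la mu j') ->
        forall p q, (p < size (P j))%N -> (q < size (P j'))%N ->
          (n j' + q < n j + p)%N].

(** The dual tableau *)

(* Column j goes to column la_1 - 1 - j, and its p-th piece (from 0) to the
   piece number size (P j) - 1 - p there.  The offsets that the text leaves
   open (the position of the first row, and the vertical distance between
   disconnected parts) are left open here too. *)
Definition is_dual (la mu : seq nat) (k : filling (skew_diagram la mu) int)
    (la' mu' : seq nat) (k' : filling (skew_diagram la' mu') int) : Prop :=
  let w := head 0%N la in
  let dcol j := col_rows la' mu' (w.-1 - j) in
  exists P n,
  [/\ (forall j, pieces_of (col_word k j) (P j)) /\ labelling la mu P n,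
      forall j, (j < w)%N ->
        pieces_of (col_word k' (w.-1 - j)) (dual_pieces (P j)),
      forall c, (w <= c)%N -> col_rows la' mu' c = [::],
      forall j p q, (p < size (P j.+1))%N -> (q < size (P j))%N ->
        (n j.+1 + p = n j + q)%N ->
        top_row (dcol j.+1) (dual_pieces (P j.+1)) ((size (P j.+1)).-1 - p)
          = bot_row (dcol j) (dual_pieces (P j)) ((size (P j)).-1 - q)
    & forall j' j, next_col la mu j' j ->
        (forall p q, (p < size (P j))%N -> (q < size (P j'))%N ->
           (n j + p <> n j' + q)%N) ->
        forall r s, r \in dcol j' -> s \in dcol j -> (r < s)%N].

(* Main.v *)
Require Import Defs.
From mathcomp Require Import all_boot all_order all_algebra finmap.
From mathcomp Require Import boolp classical_sets reals ereal esum.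
From mathcomp Require Import functions cardinality topology normedtype sequences.
From mathcomp Require Import perm zify ring.

(** A tableau that is constant along diagonals is read off one word, indexed by
    the diagonals and growing downwards: every column is the interval of that
    word from t_j to c_j - 1, and both ends decrease strictly from left to right.  The
    conditions that define I^D say that all these ends are boundaries of
    admissible pieces, so the columns are also intervals of one global sequence
    of pieces.  Passing to the dual tableau reverses this sequence, replaces each
    piece A(a, b) by A(b, a), and keeps the intervals; what has to be understood
    is how the Schur value depends on the sequence and the intervals.

    The answer is a Jacobi-Trudi formula: the value is the determinant whose
    (i, j) entry is the multiple zeta value of the part of the word between t_j
    and c_i, read as 0 when c_i < t_j ([esum_strip_tabs], [strip_zeta]).  It holds
    for arbitrary weights and already for tableaux with entries at most N, by
    induction on N: removing the entries equal to N shortens a set of columns by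
    one box each; expanding the determinant row by row gives the same recursion
    over all sets of columns, and the sets that would break the shape contribute
    determinants with two equal rows.  Letting N grow gives the formula, and with
    it the convergence of the Schur series: the words in the matrix end with a
    letter at least 2, so their values are finite.

    Reversing the sequence of pieces transposes the matrix and reverses the order
    of its rows and columns, and each entry keeps its value by the duality of
    multiple zeta values ([strip_det_dual]).  That duality is proved by connected
    sums: with C(m, n) = m! n! / (m + n)!, the sum over m > a of C(m, n) / m
    telescopes to C(a, n) / n, and this moves a word, one letter at a time, from
    one side of the kernel C to its dual on the other side ([connected_sum_YX],
    [word_zeta_dual]).  The same kernel at n = 1 bounds the values
    ([word_zeta_fin]).

    Consecutive columns that share no row do not determine a common word.  There
    one separating letter of weight zero is inserted, so every entry spanning a
    separator vanishes; this makes the value independent of the distance between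
    disconnected parts ([realizes]).

    The rest translates between skew diagrams, given by the heights of their
    columns, and strips of pieces: [schur_zeta_det] identifies the Schur value
    with the determinant, [dual_models] extracts the strip of a dual tableau from
    the rows in which its pieces lie, and [dual_exists] lays out a dual tableau
    along the reversed strip. *)

Set Implicit Arguments.
Unset Strict Implicit.
Unset Printing Implicit Defensive.
Import Order.TTheory GRing.Theory Num.Theory.
Import numFieldNormedType.Exports.
Local Open Scope classical_set_scope.
Local Open Scope ring_scope.

(** * Duality of multiple zeta values by connected sums *)

Section Connector.
Variable R : realType.
Implicit Types (u v : nat -> R) (m n : nat).

(** The kernel m! n! / (m + n)! of the connected sums; it is 1 on the axes and
    vanishes at infinity off them. *)
Definition connector m n : R := (m`! * n`!)%:R / ((m + n)`!)%:R.

(** The functions u record a nested sum by its last variable: u m is the part with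
    last variable m.  The operators below append a letter: a new variable with
    exponent 1, and one more unit of exponent on the last variable.  They
    correspond to the forms dt / (1 - t) and dt / t of the iterated integral. *)
Definition Ysum u m : R := (\sum_(a < m) u a) / m%:R.
Definition Xdiv u m : R := u m / m%:R.

Definition connected_sum u v : \bar R :=
  (\sum_(n <oo) \sum_(m <oo) (v n * (u m * connector m n))%:E)%E.

Lemma connector_ge0 m n : 0 <= connector m n.
Proof. by rewrite /connector divr_ge0. Qed.

Lemma connectorC m n : connector m n = connector n m.
Proof. by rewrite /connector mulnC addnC. Qed.

Lemma connector0 m : connector m 0 = 1.
Proof. by rewrite /connector addn0 muln1 divff// pnatr_eq0 -lt0n fact_gt0. Qed.

Lemma connectorS m n : connector m n.+1 = connector m n * (n.+1%:R / (m + n).+1%:R).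
Proof.
rewrite /connector addnS !factS !natrM.
have h : ((m + n)`!)%:R != 0 :> R by rewrite pnatr_eq0 -lt0n fact_gt0.
have h2 : ((m + n).+1)%:R != 0 :> R by rewrite pnatr_eq0.
by field; rewrite -[m%:R + _]natrD nat1r h2.
Qed.

Lemma connector1 m : connector m 1 = (m.+1%:R)^-1.
Proof. by rewrite connectorS connector0 addn0 mul1r mul1r. Qed.

Lemma connector_le m n : (0 < n)%N -> connector m n <= (m.+1%:R)^-1.
Proof.
case: n => // n _; elim: n => [|n IH]; first by rewrite connector1.
rewrite connectorS; apply: le_trans IH; rewrite ler_piMr ?connector_ge0//.
by rewrite ler_pdivrMr ?ltr0n// mul1r ler_nat; lia.
Qed.

(** The discrete counterpart of the change of variable t -> 1 - t. *)
Lemma connector_telescope m n : (0 < n)%N ->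
  connector m.+1 n / m.+1%:R = (connector m n - connector m.+1 n) / n%:R.
Proof.
move=> n0; rewrite [connector m.+1 n]connectorC connectorS [connector n m]connectorC.
have h : n%:R != 0 :> R by rewrite pnatr_eq0 -lt0n.
have h1 : m.+1%:R != 0 :> R by rewrite pnatr_eq0.
have h2 : (n + m).+1%:R != 0 :> R by rewrite pnatr_eq0.
have -> : (n + m).+1%:R = n%:R + m.+1%:R :> R by rewrite -natrD addnS.
have h3 : n%:R + m.+1%:R != 0 :> R by rewrite -natrD addnS.
by field; rewrite h ?nat1r ?h1 ?h3 //.
Qed.

Lemma nneseries_cvg (f : nat -> R) (l : R) :
  (fun N => \sum_(0 <= i < N) f i) @ \oo --> l ->
  (\sum_(i <oo) (f i)%:E = l%:E)%E.
Proof.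
move=> h; apply/cvg_lim => //.
rewrite (_ : (fun n => _) = EFin \o (fun N => \sum_(0 <= i < N) f i)); last first.
  by apply/funext => N /=; rewrite sumEFin.
by apply: cvg_EFin => //; near=> N.
Unshelve. all: by end_near. Qed.

Lemma connector_sum a n : (0 < n)%N ->
  (\sum_(m <oo) (if (a < m)%N then connector m n / m%:R else 0)%:E
   = (connector a n / n%:R)%:E)%E.
Proof.
move=> n0; apply: nneseries_cvg.
have E N : \sum_(0 <= m < N.+1) (if (a < m)%N then connector m n / m%:R else 0) =
   if (a < N)%N then (connector a n - connector N n) / n%:R else 0.
  elim: N => [|N IH]; first by rewrite big_nat1.
  rewrite big_nat_recr//= IH [in RHS]ltnS [(a < N.+1)%N]ltnS [(a <= N)%N]leq_eqVlt.
  case: (ltngtP a N) => h /=; rewrite ?addr0// ?connector_telescope//.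
    by rewrite -mulrDl addrA subrK.
  by rewrite add0r h.
rewrite -(cvg_shiftS (fun N => \sum_(0 <= m < N) _)) /=.
under eq_fun do rewrite E.
have : (fun N => (connector a n - connector N n) / n%:R) @ \oo --> (connector a n - 0) / n%:R.
  apply: cvgMr_tmp; apply: cvgB; first exact: cvg_cst.
  apply: (squeeze_cvgr (f := fun=> 0) (h := harmonic)).
  - by near=> N; rewrite connector_ge0 connector_le.
  - exact: cvg_cst.
  - exact: cvg_harmonic.
rewrite subr0; apply: cvg_trans; apply: near_eq_cvg.
by near=> N; rewrite ifT//; near: N; exact: nbhs_infty_gt.
Unshelve. all: by end_near. Qed.

Lemma Ysum_ge0 u : (forall m, 0 <= u m) -> forall m, 0 <= Ysum u m.
Proof. by move=> u0 m; rewrite divr_ge0// sumr_ge0. Qed.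

Lemma Xdiv_ge0 u : (forall m, 0 <= u m) -> forall m, 0 <= Xdiv u m.
Proof. by move=> u0 m; rewrite divr_ge0. Qed.

Lemma Ysum0 u : Ysum u 0 = 0.
Proof. by rewrite /Ysum big_ord0 mul0r. Qed.

(** Exchanging the two summations leaves, for each a, the sum over m > a that
    telescopes by [connector_sum]. *)
Lemma sum_Ysum_connector u n : (0 < n)%N -> (forall m, 0 <= u m) ->
  (\sum_(m <oo) (Ysum u m * connector m n)%:E =
   \sum_(m <oo) (u m * connector m n / n%:R)%:E)%E.
Proof.
move=> n0 u0.
pose F m a : \bar R := (u a * (if (a < m)%N then connector m n / m%:R else 0))%:E.
have F0 m a : (0 <= F m a)%E.
  by rewrite lee_fin mulr_ge0//; case: ifP => // _; rewrite divr_ge0// connector_ge0.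
transitivity (\sum_(m <oo) \sum_(a <oo) F m a)%E.
  apply: eq_eseriesr => m _; rewrite (nneseries_split 0 m)//.
  rewrite add0n [X in (_ + X)%E]eseries0 ?adde0; last first.
    by move=> i mi _; rewrite /F ltnNge mi mulr0.
  rewrite sumEFin /Ysum mulrAC -mulrA mulr_suml big_mkord.
  by congr EFin; apply: eq_bigr => a _; rewrite ltn_ord.
rewrite nneseries_interchange//; apply: eq_eseriesr => a _.
under eq_eseriesr do rewrite /F EFinM.
rewrite nneseriesZl//; last first.
  by move=> i _; rewrite lee_fin; case: ifP => // _; rewrite divr_ge0// connector_ge0.
by rewrite connector_sum// -EFinM mulrA.
Qed.

Lemma connected_sumC u v : (forall m, 0 <= u m) -> (forall m, 0 <= v m) ->
  connected_sum u v = connected_sum v u.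
Proof.
move=> u0 v0; rewrite /connected_sum nneseries_interchange; last first.
  by move=> i j; rewrite lee_fin !mulr_ge0// connector_ge0.
apply: eq_eseriesr => m _; apply: eq_eseriesr => n _.
by rewrite connectorC mulrCA.
Qed.

(** Transport of one letter: a new variable on one side is paid for by one unit of
    exponent on the other.  The value v 0 has to vanish because [Xdiv] discards
    it. *)
Lemma connected_sum_YX u v : (forall m, 0 <= u m) -> (forall m, 0 <= v m) -> v 0%N = 0 ->
  connected_sum (Ysum u) v = connected_sum u (Xdiv v).
Proof.
move=> u0 v0 v00; apply: eq_eseriesr => -[|n] _.
  by rewrite !eseries0// => i _ _; rewrite /Xdiv v00 ?mul0r// invr0 mulr0.
under eq_eseriesr do rewrite EFinM.
rewrite nneseriesZl//; last first.
  by move=> i _; rewrite lee_fin mulr_ge0 ?connector_ge0// Ysum_ge0.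
rewrite sum_Ysum_connector// -nneseriesZl//; last first.
  by move=> i _; rewrite lee_fin !mulr_ge0 ?connector_ge0.
apply: eq_eseriesr => m _; rewrite -EFinM /Xdiv; congr EFin.
by ring.
Qed.

Lemma connected_sum_XY u v : (forall m, 0 <= u m) -> (forall m, 0 <= v m) -> u 0%N = 0 ->
  connected_sum (Xdiv u) v = connected_sum u (Ysum v).
Proof.
move=> u0 v0 u00; rewrite connected_sumC//; last exact: Xdiv_ge0.
by rewrite -connected_sum_YX// connected_sumC//; exact: Ysum_ge0.
Qed.

(** The piece A(a, b) consists of a - 1 letters 1 and one letter b + 1, which opens
    a variables in all and then divides b more times by the last one. *)
Definition piece_weight u (p : nat * nat) : nat -> R :=
  iter p.2 Xdiv (iter p.1 Ysum u).

(** The empty word: the only variable is the lower bound 0. *)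
Definition delta0 : nat -> R := fun m => (m == 0%N)%:R.

Lemma iterX_ge0 b u : (forall m, 0 <= u m) -> forall m, 0 <= iter b Xdiv u m.
Proof. by move=> u0; elim: b => // b IH; exact: Xdiv_ge0. Qed.

Lemma iterY_ge0 b u : (forall m, 0 <= u m) -> forall m, 0 <= iter b Ysum u m.
Proof. by move=> u0; elim: b => // b IH; exact: Ysum_ge0. Qed.

Lemma iterX0 b u : u 0%N = 0 -> iter b Xdiv u 0%N = 0.
Proof. by move=> u0; case: b => // b; rewrite /= /Xdiv invr0 mulr0. Qed.

Lemma connected_sum_iterXY b u v : (forall m, 0 <= u m) -> (forall m, 0 <= v m) ->
  u 0%N = 0 -> connected_sum (iter b Xdiv u) v = connected_sum u (iter b Ysum v).
Proof.
move=> u0 v0 u00; elim: b v v0 => // b IH v v0.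
rewrite [iter b.+1 Ysum v]iterSr -IH; last exact: Ysum_ge0.
by rewrite /= connected_sum_XY//; [exact: iterX_ge0|exact: iterX0].
Qed.

Lemma piece_weight_ge0 p u : (forall m, 0 <= u m) -> forall m, 0 <= piece_weight u p m.
Proof. by move=> u0; apply: iterX_ge0; exact: iterY_ge0. Qed.

(** All the letters of a piece change sides in reverse order, and variables and
    divisions exchange their roles. *)
Lemma connected_sum_piece p u v : (0 < p.1)%N -> (0 < p.2)%N ->
  (forall m, 0 <= u m) -> (forall m, 0 <= v m) ->
  connected_sum (piece_weight u p) v = connected_sum u (piece_weight v (dual_piece p)).
Proof.
case: p => a b /= a0 b0 u0 v0; rewrite /piece_weight/=.
have Y0 c w : (0 < c)%N -> iter c Ysum w 0%N = 0 by case: c => // c _; exact: Ysum0.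
rewrite connected_sum_iterXY ?Y0//; last exact: iterY_ge0.
rewrite connected_sumC; [|exact: iterY_ge0..].
rewrite -connected_sum_iterXY ?Y0//; last exact: iterY_ge0.
rewrite connected_sumC//; apply: iterX_ge0; exact: iterY_ge0.
Qed.

Definition word_weight (ps : seq (nat * nat)) := foldl piece_weight delta0 ps.

Lemma word_weight_ge0 ps : forall m, 0 <= word_weight ps m.
Proof.
rewrite /word_weight; elim/last_ind: ps => [|ps p IH] m; first by rewrite /= ler0n.
by rewrite foldl_rcons; exact: piece_weight_ge0.
Qed.

Definition pos_pieces (ps : seq (nat * nat)) := all (fun p => (0 < p.1) && (0 < p.2))%N ps.

Lemma dual_pieces_rcons ps p : dual_pieces (rcons ps p) = dual_piece p :: dual_pieces ps.
Proof. by rewrite /dual_pieces rev_rcons. Qed.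

(** Against the empty word the kernel is C(m, 0) = 1, so the connected sum is the
    multiple zeta value itself. *)
Lemma connected_sum_delta u : (forall m, 0 <= u m) ->
  connected_sum u delta0 = (\sum_(m <oo) (u m)%:E)%E.
Proof.
move=> u0; rewrite /connected_sum.
rewrite (@nneseries_split _
    (fun n => \sum_(m <oo) (delta0 n * (u m * connector m n))%:E)%E 0 1); last first.
  move=> n _; apply: nneseries_ge0 => m _ _.
  by rewrite lee_fin !mulr_ge0 ?ler0n ?connector_ge0.
rewrite add0n big_nat1 [X in (_ + X)%E]eseries0 ?adde0.
  by apply: eq_eseriesr => m _; rewrite connector0 mulr1 mul1r.
by move=> [//|n] _ _; rewrite eseries0// => i _ _; rewrite mul0r.
Qed.

Lemma delta0_ge0 m : 0 <= delta0 m.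
Proof. exact: ler0n. Qed.

Lemma connected_sum_dual ps v : pos_pieces ps -> (forall m, 0 <= v m) ->
  connected_sum (word_weight ps) v = connected_sum delta0 (foldl piece_weight v (dual_pieces ps)).
Proof.
elim/last_ind: ps v => [//|ps p IH] v; rewrite /pos_pieces all_rcons => /andP[/andP[a b] h] v0.
rewrite dual_pieces_rcons /= -IH//; last exact: piece_weight_ge0.
by rewrite /word_weight foldl_rcons connected_sum_piece//; exact: word_weight_ge0.
Qed.

Definition word_zeta ps : \bar R := (\sum_(m <oo) (word_weight ps m)%:E)%E.

Lemma word_zeta_dual ps : pos_pieces ps -> word_zeta (dual_pieces ps) = word_zeta ps.
Proof.
move=> h; rewrite /word_zeta -connected_sum_delta; last exact: word_weight_ge0.
rewrite connected_sumC; [|exact: word_weight_ge0|exact: delta0_ge0].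
by rewrite -connected_sum_dual ?connected_sum_delta//; exact: word_weight_ge0.
Qed.

(** The weight C(m, 1) = 1 / (m + 1) is preserved by [Ysum] and not increased by
    [Xdiv], which controls every word at once. *)
Definition connector1_sum u : \bar R := (\sum_(m <oo) (u m * connector m 1)%:E)%E.

Lemma connector1_sum_Y u : (forall m, 0 <= u m) -> connector1_sum (Ysum u) = connector1_sum u.
Proof.
move=> u0; rewrite /connector1_sum sum_Ysum_connector//.
by apply: eq_eseriesr => m _; rewrite divr1.
Qed.

Lemma connector1_sum_X u : (forall m, 0 <= u m) ->
  (connector1_sum (Xdiv u) <= connector1_sum u)%E.
Proof.
move=> u0; apply: lee_nneseries => [m _|m _].
  by rewrite lee_fin mulr_ge0 ?connector_ge0// Xdiv_ge0.
rewrite lee_fin ler_wpM2r ?connector_ge0// /Xdiv; case: m => [|m].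
  by rewrite invr0 mulr0.
by rewrite ler_pdivrMr ?ltr0n// ler_peMr// ler1n.
Qed.

Lemma connector1_sum_piece u p : (forall m, 0 <= u m) ->
  (connector1_sum (piece_weight u p) <= connector1_sum u)%E.
Proof.
move=> u0; rewrite /piece_weight; apply: (@le_trans _ _ (connector1_sum (iter p.1 Ysum u))).
  elim: p.2 => //= b; apply: le_trans; apply: connector1_sum_X.
  by apply: iterX_ge0; exact: iterY_ge0.
by elim: p.1 => //= a IH; rewrite connector1_sum_Y//; exact: iterY_ge0.
Qed.

Lemma connector1_sum_delta : connector1_sum delta0 = 1%E.
Proof.
rewrite /connector1_sum (nneseries_split 0 1); last first.
  by move=> m _; rewrite lee_fin mulr_ge0 ?connector_ge0 ?delta0_ge0.
rewrite add0n big_nat1 [X in (_ + X)%E]eseries0 ?adde0.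
  by rewrite connector1 /delta0 mul1r invr1.
by move=> [//|m] _ _; rewrite mul0r.
Qed.

Lemma connector1_sum_word ps : (connector1_sum (word_weight ps) <= 1)%E.
Proof.
rewrite -connector1_sum_delta; elim/last_ind: ps => [//|ps p IH].
rewrite /word_weight foldl_rcons; apply: le_trans IH; apply: connector1_sum_piece;
  exact: word_weight_ge0.
Qed.

(** The last letter contributes a factor 1 / m, at most twice C(m, 1). *)
Lemma word_zeta_fin ps : pos_pieces ps -> word_zeta ps \is a fin_num.
Proof.
have z0 : (0 <= word_zeta ps)%E.
  by apply: nneseries_ge0 => m _ _; rewrite lee_fin word_weight_ge0.
elim/last_ind: ps z0 => [_ _|ps [a [|b]] _ z0]; rewrite ?/pos_pieces ?all_rcons ?andbF//.
  rewrite /word_zeta (nneseries_split 0 1) ?add0n ?big_nat1; last first.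
    by move=> m _; rewrite lee_fin delta0_ge0.
  rewrite [X in (_ + X)%E]eseries0 ?adde0// => m.
  by case: m => [//|m] _ _.
move=> /=/andP[/andP[a0 _] h]; rewrite ge0_fin_numE//.
set u := iter b Xdiv (iter a Ysum (word_weight ps)).
have u0 m : 0 <= u m by apply: iterX_ge0; apply: iterY_ge0; exact: word_weight_ge0.
apply: (@le_lt_trans _ _ (2%:E * connector1_sum u)%E); last first.
  apply: (@le_lt_trans _ _ (2%:E * 1)%E); last by rewrite mule1 ltry.
  rewrite lee_pmul2l//; apply: le_trans (connector1_sum_word ps).
  apply: (@connector1_sum_piece _ (a, b)); exact: word_weight_ge0.
rewrite /connector1_sum -nneseriesZl//; last first.
  by move=> i _; rewrite lee_fin mulr_ge0// connector_ge0.
apply: lee_nneseries => [m _|m _]; first by rewrite lee_fin word_weight_ge0.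
rewrite /word_weight foldl_rcons /piece_weight/= -/(word_weight ps) -/u.
rewrite -EFinM lee_fin /Xdiv connector1.
rewrite mulrCA ler_wpM2l//; case: m => [|m]; first by rewrite invr0 mulr_ge0.
rewrite ler_pdivlMr ?ltr0n// mulrC ler_pdivrMr ?ltr0n// -natrM ler_nat; lia.
Qed.

End Connector.

(** * A determinant for column-strict tableaux on diagonals *)

Section EsumFacts.
Variable R : realType.

Lemma esum_fin_partition (T : choiceType) (F : finType) (h : T -> F) (S : set T)
    (a : T -> \bar R) : (forall x, S x -> 0 <= a x)%E ->
  (\esum_(x in S) a x = \sum_(e : F) \esum_(x in S `&` [set x | h x = e]) a x)%E.
Proof.
move=> a0.
under eq_bigr do rewrite esum_mkcondr.
rewrite -esum_sum; last by move=> x e Sx _; case: ifP => // _; exact: a0.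
apply: eq_esum => x Sx; rewrite (bigD1 (h x))//= mem_set//.
rewrite big1 ?adde0// => e; rewrite eq_sym => /eqP ne; rewrite memNset//.
Qed.

Lemma esum_le_subset (T : choiceType) (S S' : set T) (a : T -> \bar R) :
  S `<=` S' -> (forall x, S' x -> 0 <= a x)%E ->
  (\esum_(x in S) a x <= \esum_(x in S') a x)%E.
Proof.
move=> SS a0; rewrite (esumID S S')// setIidr// leeDl// esum_ge0// => x [Sx _].
exact: a0.
Qed.

End EsumFacts.

Section JacobiTrudi.
Variables (R : realType) (w : nat) (wt : nat -> nat -> R).
Hypothesis wt_ge0 : forall d m, 0 <= wt d m.
Implicit Types (t c : 'I_w -> nat) (M : 'I_w -> nat -> nat).

Definition strict_decr c := forall i j : 'I_w, (i < j)%N -> (c j < c i)%N.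

(** At c = 0 there is no box to remove, and the weight 0 discards the term. *)
Definition last_wt (c m : nat) : R := if c is c'.+1 then wt c' m else 0.

(** The sum over strictly increasing fillings, by numbers at most N, of one column
    occupying the diagonals from t to c - 1, computed by deciding whether the last
    box holds N.  It is 1 for the empty column and 0 when c < t. *)
Fixpoint trunc_col (N t c : nat) : R :=
  if N is N'.+1 then trunc_col N' t c + last_wt c N * trunc_col N' t c.-1
  else (c == t)%:R.

(** Column j occupies the diagonals d with t j <= d < c j, and M vanishes elsewhere,
    which makes fillings of different shapes comparable.  The right neighbour of a
    box on diagonal d + 1 lies on diagonal d of the next column. *)
Definition strip_tab t c M :=
  [/\ forall j, (t j <= c j)%N,
      forall j d, (0 < M j d)%N = (t j <= d < c j)%N,
      forall j d, (t j <= d)%N -> (d.+1 < c j)%N -> (M j d < M j d.+1)%N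
    & forall (i j : 'I_w) d, j = i.+1 :> nat -> (t i <= d.+1 < c i)%N ->
        (t j <= d < c j)%N -> (M i d.+1 <= M j d)%N].

Definition strip_tab_le t c N : set ('I_w -> nat -> nat) :=
  [set M | strip_tab t c M /\ forall j d, (M j d <= N)%N].

Definition strip_wt t c M : R :=
  \prod_(j < w) \prod_(t j <= d < c j) wt d (M j d).

Lemma strip_wt_ge0 t c M : 0 <= strip_wt t c M.
Proof. by apply: prodr_ge0 => j _; apply: prodr_ge0. Qed.

Definition trunc_mx N t c : 'M[R]_w := \matrix_(i, j) trunc_col N (t j) (c i).

(** Each row is the sum of two rows, the column with or without a box N + 1 at its
    bottom; multilinearity gives a sum over all sets of columns. *)
Lemma det_trunc_mxS N t c :
  \det (trunc_mx N.+1 t c) = \sum_(e : {ffun 'I_w -> bool})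
    (\prod_(i < w) (if e i then last_wt (c i) N.+1 else 1)) *
    \det (trunc_mx N t (fun i => c i - e i)%N).
Proof.
rewrite /determinant.
under [RHS]eq_bigr do rewrite mulr_sumr.
rewrite exchange_big /=; apply: eq_bigr => s _.
transitivity ((-1) ^+ s * \prod_i \sum_(b : bool)
   ((if b then last_wt (c i) N.+1 else 1) * trunc_col N (t (s i)) (c i - b)%N)).
  congr (_ * _); apply: eq_bigr => i _; rewrite mxE big_bool/= mul1r subn0 subn1.
  by rewrite addrC.
rewrite bigA_distr_bigA /= mulr_sumr; apply: eq_bigr => e _.
rewrite big_split /= mulrCA; congr (_ * (_ * _)).
by apply: eq_bigr => i _; rewrite mxE.
Qed.

Lemma strict_decr_eq_codom t c : strict_decr t -> strict_decr c ->
  (forall i, exists j, c i = t j) -> c =1 t.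
Proof.
move=> st sc h.
have S f : strict_decr f -> sorted (fun x y => y < x)%N [seq f i | i <- enum 'I_w].
  move=> sf; rewrite sorted_map; apply: (@sub_sorted _ (relpre val ltn)).
    by move=> i j; exact: sf.
  by rewrite -sorted_map val_enum_ord iota_ltn_sorted.
have tr : transitive (fun x y => y < x)%N by move=> x y z; lia.
have ir : irreflexive (fun x y => y < x)%N by move=> x; rewrite ltnn.
have us := sorted_uniq tr ir (S c sc).
have e : [seq c i | i <- enum 'I_w] = [seq t i | i <- enum 'I_w].
  apply: (irr_sorted_eq tr ir) (S _ sc) (S _ st) _.
  have sub : {subset [seq c i | i <- enum 'I_w] <= [seq t i | i <- enum 'I_w]}.
    move=> x /mapP[i _ ->]; have [j ->] := h i.
    by apply: map_f; rewrite mem_enum.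
  have [] := uniq_min_size us sub; first by rewrite !size_map.
  by move=> _.
by move/eq_in_map: e => e i; apply: e; rewrite mem_enum.
Qed.

(** With no entry available only the empty shape contributes, and the matrix of
    coincidences between the t j and the c i is the identity or has a zero row. *)
Lemma esum_strip_tab_le0 (K : R) t c : strict_decr t -> strict_decr c -> 0 <= K ->
  (\esum_(M in strip_tab_le t c 0) (K * strip_wt t c M)%:E =
   (K * \det (trunc_mx 0 t c))%:E)%E.
Proof.
move=> st sc K0.
have [/asboolP ct|nct] := boolP (`[< c =1 t >]).
  have {}ct : c = t by apply/funext.
  rewrite ct; have -> : strip_tab_le t t 0 = [set (fun _ _ => 0%N)].
    apply/seteqP; split => [M [_ h]|M ->]/=.
      by apply/funext => j; apply/funext => d; apply/eqP; rewrite -leqn0.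
    split=> //; split=> // [j d|j d h1 h2]; lia.
  rewrite esum_set1; last by rewrite lee_fin mulr_ge0// strip_wt_ge0.
  have -> : trunc_mx 0 t t = 1%:M.
    apply/matrixP => i j; rewrite !mxE /=; congr (_%:R).
    case: (ltngtP i j) => [ij|ij|/ord_inj->]; rewrite ?eqxx//.
      have := st _ _ ij; rewrite -val_eqE /=; lia.
    have := st _ _ ij; rewrite -val_eqE /=; lia.
  rewrite det1 /strip_wt big1// => j _.
  by rewrite big_geq.
have -> : strip_tab_le t c 0 = set0.
  apply/seteqP; split => // M [[h1 h2 _ _] h3]; move/asboolP: nct; apply => j.
  have := h2 j (t j); have := h3 j (t j); have := h1 j; lia.
rewrite esum_set0; have [i hi] : exists i, forall j, c i <> t j.
  apply: contrapT => H; move/asboolP: nct; apply; apply: strict_decr_eq_codom => // i.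
  apply: contrapT => H2; apply: H; exists i => j e; apply: H2; by exists j.
rewrite (expand_det_row _ i) big1 ?mulr0// => j _; rewrite mxE/=.
by case: eqP => [/hi//|_]; rewrite mul0r.
Qed.

Definition peel c N M : {ffun 'I_w -> bool} :=
  [ffun j => (0 < c j)%N && (M j (c j).-1 == N.+1)].

Definition unpeel c N (e : {ffun 'I_w -> bool}) M : 'I_w -> nat -> nat :=
  fun j d => if e j && (d == (c j).-1) then N.+1 else M j d.

Lemma unpeel_bij t c N (e : {ffun 'I_w -> bool}) : strict_decr t -> strict_decr c ->
  (forall i, e i -> 0 < c i)%N -> strict_decr (fun i => c i - e i)%N ->
  set_bij (strip_tab_le t (fun i => c i - e i)%N N)
    (strip_tab_le t c N.+1 `&` [set M | peel c N M = e]) (unpeel c N e).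
Proof.
move=> st sc ec sce; split.
- move=> M [[h1 h2 h3 h4] h5]; split; first split; first split.
  + by move=> j; have := h1 j; lia.
  + move=> j d; have := h1 j; have := h2 j d; have := ec j.
    rewrite /unpeel; case: (e j) => /=; last by rewrite subn0.
    case: eqP => /=; lia.
  + move=> j d t1 t2; have := h3 j d t1; have := h5 j d; have := ec j.
    rewrite /unpeel; case: (e j) => /=; last by rewrite subn0 => _ _; apply.
    by do 2![case: eqP => /=]; lia.
  + move=> i j d ij hi hj.
    have lij : (i < j)%N by rewrite ij.
    have := h4 i j d ij; have := h5 i d.+1; have := sce _ _ lij.
    have := ec i; have := ec j; have := h2 i d.+1; have := h5 j d.
    rewrite /unpeel; case: (e i); case: (e j) => /=; rewrite ?subn0;
      do ?[case: eqP => /=]; lia.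
  + by move=> j d; have := h5 j d; rewrite /unpeel; case: ifP; lia.
  + apply/ffunP => j; rewrite ffunE /unpeel eqxx andbT; have := ec j.
    have := h5 j (c j).-1; case: (e j) => //=; rewrite ?eqxx ?andbT; lia.
- move=> M M'; rewrite !inE => -[[h1 h2 h3 h4] h5] [[h1' h2' h3' h4'] h5'] eM.
  apply/funext => j; apply/funext => d.
  have := congr1 (fun f => f j d) eM; rewrite /unpeel; case: ifP => [/andP[ej /eqP dc] _|_ //].
  by have := h2 j d; have := h2' j d; rewrite ej dc; have := ec j ej; clear eM; lia.
- move=> M [[[h1 h2 h3 h4] h5] /= pe].
  have pej k : e k = (0 < c k)%N && (M k (c k).-1 == N.+1) by rewrite -pe ffunE.
  exists (fun j d => if e j && (d == (c j).-1) then 0%N else M j d); last first.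
    apply/funext => j; apply/funext => d; rewrite /unpeel; case: ifP => [/andP[ej /eqP->]|->//].
    by move: ej; rewrite pej => /andP[_ /eqP->].
  have tc j : e j -> (t j < c j)%N.
    by rewrite pej => /andP[c0 /eqP m]; have := h2 j (c j).-1; rewrite m; lia.
  split; first split.
  + by move=> j; have := tc j; have := h1 j; case: (e j); lia.
  + move=> j d; have := tc j; have := h2 j d; case: (e j) => /=; last by rewrite subn0.
    by case: eqP => /=; lia.
  + move=> j d t1 t2; have := tc j; have := h3 j d t1; case: (e j) t2 => /=;
    last by rewrite subn0 => t2 h _; exact: h.
    by do 2![case: eqP => /=]; lia.
  + move=> i j d ij hi hj; have := h4 i j d ij; have := tc i; have := tc j.
    by case: (e i) hi; case: (e j) hj => /=; rewrite ?subn0; do ?[case: eqP => /=]; lia.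
  + move=> j d; have := h5 j d; rewrite leq_eqVlt; case/orP => [/eqP m|m]; last by case: ifP; lia.
    have hd := h2 j d.
    have : d = (c j).-1.
      have := h3 j d; have := h5 j d.+1; lia.
    move=> dc; rewrite pej dc eqxx andbT -dc m eqxx andbT ifT//; lia.
Qed.

(** If the bottom box of column i is removed and the bottom box of column j lies to
    its right, then the latter holds at least N + 1 and is removed as well; this is
    why the remaining ends still decrease strictly. *)
Lemma peel_empty t c N (e : {ffun 'I_w -> bool}) : strict_decr t -> strict_decr c ->
  ~ ((forall i, e i -> 0 < c i)%N /\ strict_decr (fun i => c i - e i)%N) ->
  strip_tab_le t c N.+1 `&` [set M | peel c N M = e] = set0.
Proof.
move=> st sc H; apply/seteqP; split=> // M [[[h1 h2 h3 h4] h5] /= pe]; apply: H.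
have pej j : e j = (0 < c j)%N && (M j (c j).-1 == N.+1) by rewrite -pe ffunE.
have ec i : e i -> (0 < c i)%N by rewrite pej => /andP[].
split=> // i j ij; rewrite ltnNge; apply/negP => le.
have cij := sc _ _ ij; have tij := st _ _ ij.
have ei : e i by move: le; case: (e i) => //=; case: (e j); lia.
have ci : c i = (c j).+1 by move: le; rewrite ei; case: (e j); lia.
have ej : e j = false by move: le; rewrite ei ci; case: (e j) (ec j) => //= /(_ isT); lia.
have ji : j = i.+1 :> nat.
  apply/eqP; rewrite eqn_leq ij andbT leqNgt; apply/negP => h.
  have lw : (i.+1 < w)%N by apply: ltn_trans h _; exact: ltn_ord.
  have := sc i (Ordinal lw) (leqnn _); have := sc (Ordinal lw) j h; lia.
move: ei; rewrite pej => /andP[_ /eqP mi].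
rewrite ci /= in mi; have hi := h2 i (c j); rewrite ci mi in hi.
have := h2 j (c j).-1; have := pej j; rewrite ej; have := h5 j (c j).-1.
have := h4 i j (c j).-1 ji; rewrite prednK; last by lia.
rewrite mi; case: eqP; lia.
Qed.

(** A set of columns excluded by [peel_empty] takes a box from a column ending at 0,
    at weight 0, or makes two ends coincide, hence two rows equal. *)
Lemma det_not_strict_decr N t c (e : {ffun 'I_w -> bool}) : strict_decr c ->
  ~ ((forall i, e i -> 0 < c i)%N /\ strict_decr (fun i => c i - e i)%N) ->
  (\prod_(i < w) (if e i then last_wt (c i) N.+1 else 1)) *
    \det (trunc_mx N t (fun i => c i - e i)%N) = 0.
Proof.
move=> sc H.
have [ec|/existsNP[i /not_implyP[ei ci]]] := pselect (forall i, e i -> 0 < c i)%N; last first.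
  rewrite (bigD1 i)//= ei; have -> : c i = 0%N by lia.
  by rewrite /= !mul0r.
have [i [j [ij le]]] : exists i j : 'I_w, (i < j)%N /\ (c i - e i <= c j - e j)%N.
  apply: contrapT => H2; apply: H; split=> // i j ij; rewrite ltnNge; apply/negP => le.
  by apply: H2; exists i, j.
have eq : (c i - e i = c j - e j)%N.
  by have := sc _ _ ij; move: le; case: (e i); case: (e j); lia.
rewrite (@determinant_alternate _ _ _ i j) ?mulr0//.
  by apply/eqP => E; rewrite E ltnn in ij.
by move=> k; rewrite !mxE eq.
Qed.

Lemma strip_wt_unpeel t c N (e : {ffun 'I_w -> bool}) M :
  (forall i, e i -> 0 < c i)%N -> (forall i, t i <= c i - e i)%N ->
  strip_wt t c (unpeel c N e M) =
  (\prod_(i < w) (if e i then last_wt (c i) N.+1 else 1)) *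
   strip_wt t (fun i => c i - e i)%N M.
Proof.
move=> ec tc; rewrite /strip_wt -big_split /=; apply: eq_bigr => i _.
have := tc i; have := ec i; rewrite /unpeel; case: (e i) => /= [|_ _];
  last by rewrite subn0 mul1r.
move=> /(_ isT); case: (c i) => // c' _; rewrite subn1 /= => tc'.
rewrite big_nat_recr//= eqxx mulrC; congr (_ * _).
apply: eq_big_nat => d /andP[_ dc]; by rewrite ltn_eqF.
Qed.

(** The factor K absorbs the weight of the removed boxes, so that the induction
    needs no rule for constants in front of the sum. *)
Lemma esum_strip_tab_le N (K : R) t c : strict_decr t -> strict_decr c -> 0 <= K ->
  (\esum_(M in strip_tab_le t c N) (K * strip_wt t c M)%:E =
   (K * \det (trunc_mx N t c))%:E)%E.
Proof.
move=> st; elim: N K c => [|N IH] K c sc K0; first exact: esum_strip_tab_le0.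
rewrite (@esum_fin_partition _ _ _ (peel c N)); last first.
  by move=> M _; rewrite lee_fin mulr_ge0// strip_wt_ge0.
rewrite det_trunc_mxS mulr_sumr -sumEFin; apply: eq_bigr => e _.
have [[ec sce]|H] :=
  pselect ((forall i, e i -> 0 < c i)%N /\ strict_decr (fun i => c i - e i)%N); last first.
  by rewrite det_not_strict_decr// mulr0 peel_empty// esum_set0.
rewrite (@reindex_esum _ _ _ _ _ _ _ (unpeel_bij N st sc ec sce)).
rewrite mulrA -IH//; last first.
  rewrite mulr_ge0// prodr_ge0// => i _; case: ifP => // _; rewrite /last_wt.
  by case: (c i).
apply: eq_esum => M [[h1 _ _ _] _]; rewrite strip_wt_unpeel//.
by rewrite mulrA.
Qed.

Definition strip_tabs t c : set ('I_w -> nat -> nat) := [set M | strip_tab t c M].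

Lemma strip_tab_bounded t c M : strip_tab t c M ->
  exists N, forall j d, (M j d <= N)%N.
Proof.
move=> [_ h _ _].
exists (\max_(x : 'I_w) \max_(d < c x) M x d)%N => j d.
have [dc|dc] := ltnP d (c j).
  apply: leq_trans (leq_bigmax j).
  exact: (leq_bigmax (F := fun d : 'I_(c j) => M j d) (Ordinal dc)).
by have := h j d; case: (M j d) => // m; lia.
Qed.

(** A finite set of tableaux has bounded entries. *)
Lemma esum_strip_tabs_sup t c :
  (\esum_(M in strip_tabs t c) (strip_wt t c M)%:E =
   ereal_sup (range (fun N => \esum_(M in strip_tab_le t c N) (strip_wt t c M)%:E)))%E.
Proof.
have W0 M : (0 <= (strip_wt t c M)%:E)%E by rewrite lee_fin strip_wt_ge0.
apply/eqP; rewrite eq_le; apply/andP; split; last first.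
  apply: ge_ereal_sup => _ [N _ <-]; apply: esum_le_subset => // M [].
  by [].
apply: ge_ereal_sup => _ [F [finF FS] <-].
have [N hN] : exists N, F `<=` strip_tab_le t c N.
  (* A bound for the entries of M, with default 0 if there is none. *)
  pose b (M : 'I_w -> nat -> nat) : nat :=
    if pselect (exists N, forall j d, (M j d <= N)%N) is left p then projT1 (cid p) else 0%N.
  exists (\max_(M <- finmap.enum_fset (fset_set F)) b M)%N => M FM.
  split; first exact: FS.
  move=> j d; apply: (@leq_trans (b M)).
    rewrite /b; case: pselect => [p|]; first by case: cid.
    by move=> []; apply: (@strip_tab_bounded t c); exact: FS.
  by apply: leq_bigmax_seq => //; rewrite in_fset_set// inE.
apply: (@le_trans _ _ (\esum_(M in strip_tab_le t c N) (strip_wt t c M)%:E)%E).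
  by apply: esum_ge; exists F.
by apply: ereal_sup_ubound; exists N.
Qed.

Lemma cvg_sum_seq (I : Type) (r : seq I) (P : pred I) (f : I -> nat -> R) (l : I -> R) :
  (forall i, f i @ \oo --> l i) ->
  (fun n => \sum_(i <- r | P i) f i n) @ \oo --> \sum_(i <- r | P i) l i.
Proof.
move=> h; elim: r => [|i r IH].
  under eq_fun do rewrite big_nil.
  rewrite big_nil; exact: cvg_cst.
under eq_fun do rewrite big_cons.
by rewrite big_cons; case: (P i) => //; apply: cvgD.
Qed.

Lemma cvg_prod_seq (I : Type) (r : seq I) (P : pred I) (f : I -> nat -> R) (l : I -> R) :
  (forall i, f i @ \oo --> l i) ->
  (fun n => \prod_(i <- r | P i) f i n) @ \oo --> \prod_(i <- r | P i) l i.
Proof.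
move=> h; elim: r => [|i r IH].
  under eq_fun do rewrite big_nil.
  rewrite big_nil; exact: cvg_cst.
under eq_fun do rewrite big_cons.
by rewrite big_cons; case: (P i) => //; apply: cvgM.
Qed.

(** Jacobi-Trudi for unbounded tableaux, by continuity of the determinant. *)
Lemma esum_strip_tabs t c (L : 'I_w -> 'I_w -> R) : strict_decr t -> strict_decr c ->
  (forall i j, (fun N => trunc_col N (t j) (c i)) @ \oo --> L i j) ->
  (\esum_(M in strip_tabs t c) (strip_wt t c M)%:E = (\det (\matrix_(i, j) L i j))%:E)%E.
Proof.
move=> st sc hL; rewrite esum_strip_tabs_sup.
have E N : (\esum_(M in strip_tab_le t c N) (strip_wt t c M)%:E = (\det (trunc_mx N t c))%:E)%E.
  have := esum_strip_tab_le N st sc ler01; rewrite mul1r => <-.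
  by apply: eq_esum => M _; rewrite mul1r.
apply: (@cvg_unique _ _ ((fun N => (\det (trunc_mx N t c))%:E) @ \oo)) => //.
  rewrite (_ : (fun N => _) = (fun N => \esum_(M in strip_tab_le t c N) (strip_wt t c M)%:E)%E);
    last first.
    by apply/funext => N; rewrite E.
  apply: ereal_nondecreasing_cvgn => m n mn; apply: esum_le_subset => [M [h1 h2]|M _].
    by split=> // j d; apply: leq_trans mn.
  by rewrite lee_fin strip_wt_ge0.
apply: cvg_EFin; first by near=> N.
rewrite /determinant /comp/=; apply: cvg_sum_seq => s.
apply: cvgMl_tmp; apply: cvg_prod_seq => i.
rewrite mxE; under eq_fun do rewrite mxE.
exact: hL.
Unshelve. all: by end_near. Qed.

End JacobiTrudi.

(** * Words and their multiple zeta values *)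

Section Words.
Variable R : realType.
Implicit Types (f u : nat -> R) (x : option int) (ws : seq (option int)).
Implicit Types (ps : seq (nat * nat)) (qs : seq (option (nat * nat))).

(** The letter None is a separator: a box carrying it has weight zero. *)
Definition letter_wt x m : R := if x is Some k then m%:R ^ (- k) else 0.

Lemma letter_wt_ge0 x m : 0 <= letter_wt x m.
Proof. by case: x => // k; rewrite /letter_wt exprz_ge0. Qed.

(** Appends one letter to a truncated nested sum: the new variable is m + 1, and the
    earlier ones are at most m. *)
Definition sum_step f x N : R := \sum_(m < N) letter_wt x m.+1 * f m.

Definition word_sum ws : nat -> R := foldl sum_step (fun=> 1) ws.

Lemma word_sum_rcons ws x : word_sum (rcons ws x) = sum_step (word_sum ws) x.
Proof. by rewrite /word_sum foldl_rcons. Qed.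

Lemma word_sum_rconsS ws x N :
  word_sum (rcons ws x) N.+1 = word_sum (rcons ws x) N + letter_wt x N.+1 * word_sum ws N.
Proof. by rewrite word_sum_rcons /sum_step big_ord_recr. Qed.

Lemma trunc_col_lt (A : seq (option int)) N t c : (c < t)%N ->
  trunc_col (fun d => letter_wt (nth None A d)) N t c = 0.
Proof.
elim: N c => [|N IH] c ct /=; first by rewrite ltn_eqF.
by rewrite !IH ?mulr0 ?addr0//; lia.
Qed.

Lemma trunc_col_word_sum (A : seq (option int)) N t c : (t <= c <= size A)%N ->
  trunc_col (fun d => letter_wt (nth None A d)) N t c = word_sum (drop t (take c A)) N.
Proof.
elim: N c => [|N IH] c /andP[tc cA].
  rewrite /=; move: tc; rewrite leq_eqVlt => /predU1P[<-|tc].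
    by rewrite eqxx drop_oversize// size_take; case: ifP; lia.
  rewrite gtn_eqF//; case: c tc cA => // c tc cA.
  rewrite (take_nth None)// drop_rcons ?word_sum_rcons ?/sum_step ?big_ord0//.
  by rewrite size_take cA; lia.
move: tc; rewrite leq_eqVlt => /predU1P[tc|tc].
  rewrite [LHS]/= IH ?tc ?leqnn//; rewrite drop_oversize ?size_take; last by case: ifP; lia.
  case: c tc cA => [|c] tc cA; first by rewrite mul0r addr0.
  by rewrite trunc_col_lt ?mulr0 ?addr0// -tc.
case: c tc cA => // c tc cA.
rewrite [LHS]/= !IH; [|lia..].
rewrite (take_nth None)// drop_rcons; last by rewrite size_take cA; lia.
by rewrite word_sum_rconsS.
Qed.

Definition expand_piece (p : option (nat * nat)) : seq (option int) :=
  if p is Some p then [seq Some k | k <- piece p] else [:: None].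

Definition expand_strip qs := flatten [seq expand_piece q | q <- qs].

(** A letter b + 1 is one application of [Ysum] followed by b of [Xdiv]; the term of
    index 0 vanishes and accounts for the shift. *)
Lemma sum_step_weight f u b : (forall N, f N = \sum_(m < N.+1) u m) ->
  forall N, sum_step f (Some b.+1%:Z) N = \sum_(m < N.+1) iter b (@Xdiv R) (Ysum u) m.
Proof.
move=> fu N; rewrite big_ord_recl.
have E b' m : iter b' (@Xdiv R) (Ysum u) m = Ysum u m / m%:R ^+ b'.
  elim: b' => [|b' IH] /=; first by rewrite divr1.
  by rewrite {1}/Xdiv IH exprS invfM -mulrA [_^-1 * _^-1]mulrC.
rewrite E Ysum0 mul0r add0r; apply: eq_bigr => m _.
rewrite E /Ysum /= fu /bump /= add1n -exprnN exprS invfM.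
by rewrite mulrC mulrA.
Qed.

Lemma word_sum_piece f u p : (0 < p.1)%N -> (0 < p.2)%N ->
  (forall N, f N = \sum_(m < N.+1) u m) ->
  forall N, foldl sum_step f (expand_piece (Some p)) N = \sum_(m < N.+1) piece_weight u p m.
Proof.
case: p => [[//|a] b] /= _ b0 fu.
rewrite /expand_piece /piece /= map_rcons map_nseq -cats1 foldl_cat /=.
rewrite /piece_weight /= => N.
apply: sum_step_weight => {N}.
elim: a f u fu => [|a IH] f u fu N //=.
by rewrite (IH _ (Ysum u)) -?iterSr//; exact: (@sum_step_weight _ _ 0).
Qed.

Lemma expand_rcons qs q : expand_strip (rcons qs q) = expand_strip qs ++ expand_piece q.
Proof. by rewrite /expand_strip map_rcons flatten_rcons. Qed.

Lemma word_sum_weight ps : pos_pieces ps -> forall N,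
  word_sum (expand_strip [seq Some p | p <- ps]) N = \sum_(m < N.+1) word_weight R ps m.
Proof.
elim/last_ind: ps => [_ N|ps p IH]; last first.
  rewrite /pos_pieces all_rcons => /andP[/andP[a b] h] N.
  rewrite map_rcons expand_rcons /word_sum foldl_cat (@word_sum_piece _ (word_weight R ps))//.
    by rewrite /word_weight foldl_rcons.
  exact: IH.
rewrite /word_sum /= big_ord_recl /= big1 ?addr0// => m _.
Qed.

Lemma word_sum_none ws N : None \in ws -> word_sum ws N = 0.
Proof.
elim/last_ind: ws N => // ws x IH N; rewrite mem_rcons inE word_sum_rcons /sum_step =>
  /orP[/eqP<-|h].
  by rewrite big1// => m _; rewrite mul0r.
by rewrite big1// => m _; rewrite IH// mulr0.
Qed.

Definition pos_strip qs := pos_pieces (pmap id qs).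

Definition word_lim qs : R := if None \in qs then 0 else fine (word_zeta R (pmap id qs)).

Lemma some_pmap qs : None \notin qs -> qs = [seq Some p | p <- pmap id qs].
Proof.
by elim: qs => //= -[p|] qs IH; rewrite inE //= => h; rewrite -IH.
Qed.

Lemma word_sum_cvg qs : pos_strip qs -> word_sum (expand_strip qs) @ \oo --> word_lim qs.
Proof.
move=> h; rewrite /word_lim; case: ifPn => hN.
  rewrite (_ : word_sum _ = fun=> 0); first exact: cvg_cst.
  apply/funext => N; apply: word_sum_none; apply/flattenP.
  by exists [:: None]; rewrite ?inE//; apply/mapP; exists None.
have e := word_sum_weight h; rewrite -(some_pmap hN) in e; rewrite (funext e).
have hc := @is_cvg_nneseries R (fun m => (word_weight R (pmap id qs) m)%:E) xpredT 0
  (fun m _ _ => word_weight_ge0 R _ m).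
rewrite -/(word_zeta R (pmap id qs)) in hc.
rewrite -(fineK (word_zeta_fin R h)) in hc.
have hf := fine_cvg hc; rewrite -cvg_shiftS /= in hf.
have -> : (fun N => \sum_(m < N.+1) word_weight R (pmap id qs) m) = (fun n =>
    fine (\sum_(0 <= m < n.+1) (word_weight R (pmap id qs) m)%:E)%E).
  by apply/funext => N; rewrite sumEFin /= big_mkord.
exact: hf.
Qed.

Definition dual_strip qs := rev [seq omap dual_piece q | q <- qs].

Lemma word_lim_dual qs : pos_strip qs -> word_lim (dual_strip qs) = word_lim qs.
Proof.
move=> h; rewrite /word_lim /dual_strip mem_rev.
have -> : (None \in [seq omap dual_piece q | q <- qs]) = (None \in qs).
  by elim: qs {h} => //= -[p|] qs IH; rewrite !inE IH.
case: ifPn => // hN; rewrite -(word_zeta_dual R h); congr (fine (word_zeta R _)).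
rewrite {1}(some_pmap hN) /dual_pieces -map_comp -map_rev.
by elim: (rev _) => //= p s ->.
Qed.

End Words.

(** * Strips of admissible pieces *)

Section Strip.
Implicit Types (P : nat -> seq (nat * nat)) (V s : nat -> nat).
Implicit Types (G : seq (option (nat * nat))).
Local Open Scope nat_scope.

(** V j is the number of first indices shared by the pieces of columns j and j + 1.
    The piece with index i in column j + 1 precedes the piece with index i in
    column j on the common word, so when V j > 0 the columns have V j - 1 pieces in
    common, the last ones of column j + 1 and the first ones of column j.  When
    V j = 0 they are not connected. *)
Definition link_ok w P V :=
  forall j, j.+1 < w -> [/\ V j <= size (P j), V j <= size (P j.+1)
    & 0 < V j -> drop (size (P j.+1) - (V j).-1) (P j.+1) = take (V j).-1 (P j)].

Definition strip_end P s j := s j + size (P j).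

(** G is the global sequence of pieces and column j starts at position s j in it.  The
    fourth clause covers both cases of a pair of neighbours: they overlap in
    V j - 1 pieces, or, if V j = 0, one separator lies between them. *)
Definition realizes w P V G s :=
  [/\ pos_strip G,
      forall j, j < w -> strip_end P s j <= size G,
      forall j, j < w -> take (size (P j)) (drop (s j) G) = [seq Some p | p <- P j],
      forall j, j.+1 < w -> s j + V j = (strip_end P s j.+1).+1
    & forall j, j.+1 < w -> V j = 0 -> nth None G (strip_end P s j.+1) = None].

Lemma pos_strip_cat G G' : pos_strip (G ++ G') = pos_strip G && pos_strip G'.
Proof. by rewrite /pos_strip pmap_cat /pos_pieces all_cat. Qed.

Lemma pos_strip_some ps : pos_strip [seq Some p | p <- ps] = pos_pieces ps.
Proof. by rewrite /pos_strip; congr pos_pieces; elim: ps => //= p s ->. Qed.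

(** The columns are laid out from right to left, each one adding to G the pieces that
    its right neighbour does not already provide. *)
Lemma realization_exists w P V : (forall j, j < w -> pos_pieces (P j)) ->
  link_ok w P V -> exists G s, realizes w P V G s.
Proof.
move=> hP hL.
suff [G [s [h _]]] : exists G s, realizes w P V G s /\
    (0 < w -> strip_end P s 0 = size G) by exists G, s.
elim: w P V hP hL => [|w IH] P V hP hL; first by exists [::], (fun=> 0).
have [|j jw|G [s [[h1 h2 h3 h4 h5] h0]]] := IH (P \o S) (V \o S).
- by move=> j jw; exact: hP.
- exact: hL.
have [w0|w0] := posnP w.
  exists [seq Some p | p <- P 0], (fun=> 0).
  split; last by rewrite /strip_end size_map.
  split; rewrite ?pos_strip_some ?w0.
  + exact: hP.
  + by case=> // _; rewrite /strip_end size_map.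
  + by case=> // _; rewrite drop0 take_oversize// size_map.
  + by [].
  + by [].
have {}h0 := h0 w0; rewrite /strip_end /= in h0.
have [V0|V0] := posnP (V 0).
  exists (G ++ None :: [seq Some p | p <- P 0]),
    (fun j => if j is j'.+1 then s j' else (size G).+1).
  have hw j : j < w -> s j + size (P j.+1) <= size G by exact: h2.
  split; last by rewrite /strip_end size_cat /= size_map addSn addnS.
  split.
  + by rewrite pos_strip_cat h1 /= /pos_strip /= -/(pos_strip _) pos_strip_some hP.
  + move=> [|j] jw; rewrite /strip_end size_cat /= size_map; first by lia.
    by have := hw j jw; lia.
  + move=> [|j] jw.
      by rewrite drop_cat ltnNge leqnSn /= subSn// subnn /= drop0 take_oversize// size_map.
    rewrite drop_cat; case: ltnP => sj.
      rewrite takel_cat; first exact: h3.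
      by rewrite size_drop; have := hw j jw; lia.
    have -> : P j.+1 = [::] by apply: size0nil; have := hw j jw; lia.
    by rewrite take0.
  + move=> [|j] jw; rewrite /strip_end /=; first by rewrite V0 addn0 h0.
    by have := h4 j jw; rewrite /strip_end.
  + move=> [|j] jw V'; rewrite /strip_end /=; first by rewrite nth_cat h0 ltnn subnn.
    have := h5 j jw V'; have := h4 j jw; have := hw j; rewrite /strip_end /= nth_cat V' => a b ->.
    by rewrite ifT//; lia.
have [|v1 v2 v3] := hL 0; first by lia.
have {}v3 := v3 V0; set y := (V 0).-1 in v3.
exists (G ++ [seq Some p | p <- drop y (P 0)]),
  (fun j => if j is j'.+1 then s j' else size G - y).
have hw j : j < w -> s j + size (P j.+1) <= size G by exact: h2.
have yG : y <= size G by lia.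
split; last by rewrite /strip_end size_cat /= size_map size_drop; lia.
split.
+ rewrite pos_strip_cat h1 /= pos_strip_some /pos_pieces; have := hP 0 isT;
  rewrite /pos_pieces -{1}(cat_take_drop y (P 0)) all_cat.
  by case/andP.
+ move=> [|j] jw; rewrite /strip_end size_cat /= size_map size_drop; first by lia.
  by have := hw j jw; lia.
+ move=> [|j] jw.
    have e : drop (size G - y) G = [seq Some p | p <- take y (P 0)].
      rewrite -v3 map_drop -(h3 0 w0) /=.
      rewrite take_oversize; last by rewrite size_drop; lia.
      rewrite drop_drop; congr drop; lia.
    rewrite drop_cat; case: ltnP => sG.
      rewrite e -map_cat cat_take_drop take_oversize// size_map//.
    have -> : y = 0 by lia.
    by rewrite subn0 subnn !drop0 take_oversize// size_map.
  rewrite drop_cat; case: ltnP => sj.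
    rewrite takel_cat; first exact: h3.
    by rewrite size_drop; have := hw j jw; lia.
  have -> : P j.+1 = [::] by apply: size0nil; have := hw j jw; lia.
  by rewrite take0.
+ move=> [|j] jw; rewrite /strip_end /=; first by lia.
  by have := h4 j jw; rewrite /strip_end.
+ move=> [|j] jw V'; rewrite /strip_end /=; first by lia.
  have := h5 j jw V'; have := h4 j jw; have := hw j; rewrite /strip_end /= nth_cat V' => a b ->.
  by rewrite ifT//; lia.
Qed.

Definition dual_cols w P j := dual_pieces (P (w.-1 - j)).
Definition dual_links w V j := V (w.-2 - j).
Definition dual_starts w P G s j := size G - strip_end P s (w.-1 - j).

Lemma size_dual_pieces ps : size (dual_pieces ps) = size ps.
Proof. by rewrite size_map size_rev. Qed.

Lemma size_dual_strip G : size (dual_strip G) = size G.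
Proof. by rewrite size_rev size_map. Qed.

Lemma pos_strip_dual G : pos_strip (dual_strip G) = pos_strip G.
Proof.
rewrite /pos_strip /dual_strip /pos_pieces -map_rev.
transitivity (all (fun p => (0 < p.1) && (0 < p.2)) (pmap id (rev G))).
  by elim: (rev G) => //= -[p|] qs IH //=; rewrite IH [_ && (0 < p.1)]andbC.
have -> : pmap id (rev G) = rev (pmap id G).
  by elim: G => //= -[p|] qs IH; rewrite rev_cons -cats1 pmap_cat IH /= ?cats0// rev_cons cats1.
by rewrite all_rev.
Qed.

Lemma rev_slice (T : Type) (X : seq T) a b : a <= size X -> b <= size X ->
  drop (size X - a) (take (size X - b) (rev X)) = rev (drop b (take a X)).
Proof.
move=> aX bX; rewrite take_rev subKn// drop_rev size_drop.
have [ab|ab] := leqP b a; last first.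
  have -> : size X - b - (size X - a) = 0 by lia.
  by rewrite take0 drop_oversize// size_take; case: ifP; lia.
have -> : size X - b - (size X - a) = a - b by lia.
by rewrite take_drop subnK.
Qed.

Lemma take_drop_slice (T : Type) (X : seq T) a n : take n (drop a X) = drop a (take (a + n) X).
Proof. by rewrite take_drop addnC. Qed.

Lemma slice_dual G a b : a <= size G -> b <= size G ->
  drop (size G - a) (take (size G - b) (dual_strip G)) = dual_strip (drop b (take a G)).
Proof.
by move=> aG bG;
  rewrite /dual_strip -(size_map (omap dual_piece) G) rev_slice ?size_map// map_drop map_take.
Qed.

Lemma dual_strip_some ps : dual_strip [seq Some p | p <- ps] = [seq Some p | p <- dual_pieces ps].
Proof. by rewrite /dual_strip /dual_pieces -!map_rev -!map_comp. Qed.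

Lemma dual_end w P V G s j : realizes w P V G s -> j < w ->
  strip_end (dual_cols w P) (dual_starts w P G s) j = size G - s (w.-1 - j).
Proof.
move=> [_ h2 _ _ _] jw; have := h2 (w.-1 - j).
rewrite /strip_end /dual_cols /dual_starts size_dual_pieces /strip_end; lia.
Qed.

Lemma realizes_dual w P V G s : realizes w P V G s ->
  realizes w (dual_cols w P) (dual_links w V) (dual_strip G) (dual_starts w P G s).
Proof.
move=> H; have [h1 h2 h3 h4 h5] := H; split.
- by rewrite pos_strip_dual.
- by move=> j jw; rewrite (dual_end H)// size_dual_strip; lia.
- move=> j jw; have hj : w.-1 - j < w by lia.
  have := h2 _ hj; have := h3 _ hj; rewrite take_drop_slice /dual_cols.
  set i := w.-1 - j; rewrite -/(strip_end P s i) => e hi.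
  rewrite take_drop_slice.
  have -> : dual_starts w P G s j + size (dual_pieces (P i)) = size G - s i.
    by rewrite -(dual_end H jw).
  by rewrite slice_dual// ?e ?dual_strip_some//; move: hi; rewrite /strip_end; lia.
- move=> j jw; rewrite (dual_end H)//.
  have hi : (w.-2 - j).+1 < w by lia.
  have := h4 _ hi; have := h2 _ hi; have := h2 _ (ltnW hi).
  rewrite /dual_starts /dual_links.
  have -> : w.-1 - j = (w.-2 - j).+1 by lia.
  have -> : w.-1 - j.+1 = w.-2 - j by lia.
  by rewrite /strip_end; lia.
- move=> j jw V0; rewrite (dual_end H)//.
  have hi : (w.-2 - j).+1 < w by lia.
  have := h4 _ hi; have := h5 _ hi V0; have := h2 _ (ltnW hi).
  rewrite [V _]V0.
  have -> : w.-1 - j.+1 = w.-2 - j by lia.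
  set k := w.-2 - j => hk hN hs.
  have sG : s k <= size G by move: hk; rewrite /strip_end; lia.
  rewrite /dual_strip nth_rev ?size_map; last by lia.
  have -> : size G - (size G - s k).+1 = strip_end P s k.+1 by lia.
  by rewrite (nth_map None) ?hN//; lia.
Qed.

Variable R : realType.

Definition strip_entry G (a b : nat) : R :=
  if a <= b then word_lim R (drop a (take b G)) else 0%R.

Definition strip_mx w P G s : 'M[R]_w :=
  \matrix_(i, j) strip_entry G (s j) (strip_end P s i).

Lemma det_rev_ord w (M : 'M[R]_w) :
  (\det (\matrix_(i, j) M (rev_ord i) (rev_ord j)) = \det M)%R.
Proof.
pose p := perm (@rev_ord_inj w).
have -> : (\matrix_(i, j) M (rev_ord i) (rev_ord j) = row_perm p (col_perm p M))%R.
  by apply/matrixP => i j; rewrite !mxE !permE.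
rewrite row_permE col_permE !det_mulmx !det_perm odd_permV mulrCA -expr2 sqrr_sign mulr1//.
Qed.

Lemma pos_strip_slice G a b : pos_strip G -> pos_strip (drop a (take b G)).
Proof.
move=> h; have : pos_strip (take b G) by move: h;
  rewrite -{1}(cat_take_drop b G) pos_strip_cat => /andP[].
by rewrite -{1}(cat_take_drop a (take b G)) pos_strip_cat => /andP[].
Qed.

(** Reversal exchanges the two ends of all intervals, that is, rows and columns of
    the matrix, and reverses the order of the columns of the tableau; the entries
    agree by duality of multiple zeta values. *)
Lemma strip_det_dual w P V G s : realizes w P V G s ->
  (\det (strip_mx w (dual_cols w P) (dual_strip G) (dual_starts w P G s)) =
   \det (strip_mx w P G s))%R.
Proof.
move=> H; have [h1 h2 h3 h4 h5] := H.
rewrite -[RHS]det_tr -[RHS]det_rev_ord; congr (\det _)%R.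
apply/matrixP => i j; rewrite !mxE (dual_end H)//.
have e (k : 'I_w) : nat_of_ord (rev_ord k) = w.-1 - k by rewrite /=; lia.
rewrite /dual_starts !e.
have := h2 (w.-1 - i); have := h2 (w.-1 - j); have := ltn_ord i; have := ltn_ord j.
rewrite /strip_entry; set a := strip_end P s (w.-1 - j) => jw iw aG bG.
have {}aG : a <= size G by apply: aG; lia.
have {}bG : s (w.-1 - i) <= size G.
  by apply: leq_trans (bG _); [rewrite /strip_end; lia|lia].
have -> : (size G - a <= size G - s (w.-1 - i)) = (s (w.-1 - i) <= a) by lia.
case: ifP => // _; rewrite slice_dual// word_lim_dual//.
exact: pos_strip_slice.
Qed.

(** The position, among letters, of a boundary between pieces. *)
Definition strip_pos G g := size (expand_strip (take g G)).

Lemma expand_cat G G' : expand_strip (G ++ G') = expand_strip G ++ expand_strip G'.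
Proof. by rewrite /expand_strip map_cat flatten_cat. Qed.

Lemma size_expand_piece q : 0 < size (expand_piece q).
Proof. by case: q => [p|]//; rewrite /expand_piece size_map /piece size_rcons. Qed.

Lemma size_expand_gt0 G : (0 < size (expand_strip G)) = (0 < size G).
Proof.
case: G => //= q G; rewrite /expand_strip /= size_cat; have := size_expand_piece q; lia.
Qed.

Lemma slice_split (T : Type) (X : seq T) a b : a <= b ->
  take b X = take a X ++ drop a (take b X).
Proof. by move=> ab; rewrite -{1}(cat_take_drop a (take b X)) take_takel. Qed.

Lemma strip_pos_lt G a b : a < b -> b <= size G -> strip_pos G a < strip_pos G b.
Proof.
move=> ab bG; rewrite /strip_pos (@slice_split _ _ a b) ?(ltnW ab)// expand_cat size_cat.
have : 0 < size (expand_strip (drop a (take b G))).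
  by rewrite size_expand_gt0 size_drop size_takel//; lia.
lia.
Qed.

Lemma strip_pos_le G a b : a <= b -> b <= size G -> strip_pos G a <= strip_pos G b.
Proof. by rewrite leq_eqVlt => /predU1P[->//|ab] bG; rewrite ltnW// strip_pos_lt. Qed.

Lemma strip_pos_size G : strip_pos G (size G) = size (expand_strip G).
Proof. by rewrite /strip_pos take_size. Qed.

Lemma expand_slice G a b : a <= b -> b <= size G ->
  drop (strip_pos G a) (take (strip_pos G b) (expand_strip G)) = expand_strip (drop a (take b G)).
Proof.
move=> ab bG.
have -> : expand_strip G = expand_strip (take b G) ++ expand_strip (drop b G).
  by rewrite -expand_cat cat_take_drop.
have e : expand_strip (take b G) = expand_strip (take a G) ++ expand_strip (drop a (take b G)).
  by rewrite -expand_cat -slice_split.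
by rewrite take_size_cat// e drop_size_cat.
Qed.

Definition letter_of G d (m : nat) : R := letter_wt R (nth None (expand_strip G) d) m.

Lemma realizes_strict_decr w P V G s : link_ok w P V -> realizes w P V G s ->
  strict_decr (fun j : 'I_w => s j) /\ strict_decr (fun j : 'I_w => strip_end P s j).
Proof.
move=> hL [_ h2 _ h4 _].
have step j : j.+1 < w -> s j.+1 < s j /\ strip_end P s j.+1 < strip_end P s j.
  by move=> jw; have [] := hL j jw; have := h4 j jw; rewrite /strip_end; lia.
have mono (f : nat -> nat) : (forall j, j.+1 < w -> f j.+1 < f j) ->
  strict_decr (fun j : 'I_w => f j).
  move=> hf i [j jw] /=; elim: j jw => // j IH jw; rewrite ltnS leq_eqVlt => /predU1P[ij|ij].
    by rewrite ij; exact: hf.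
  by apply: ltn_trans (IH (ltnW jw) ij); exact: hf.
by split; apply: mono => j jw; have [] := step j jw.
Qed.

Lemma strip_zeta w P V G s : link_ok w P V -> realizes w P V G s ->
  (\esum_(M in strip_tabs (fun j : 'I_w => strip_pos G (s j))
        (fun j : 'I_w => strip_pos G (strip_end P s j)))
     (strip_wt (letter_of G) (fun j : 'I_w => strip_pos G (s j))
        (fun j : 'I_w => strip_pos G (strip_end P s j)) M)%:E
   = (\det (strip_mx w P G s))%:E)%E.
Proof.
move=> hL H; have [st sc] := realizes_strict_decr hL H; have [h1 h2 h3 h4 h5] := H.
have sG (j : 'I_w) : s j <= size G by apply: leq_trans (h2 _ (ltn_ord j));
  rewrite /strip_end leq_addr.
rewrite /strip_mx;
  apply: (@esum_strip_tabs R w (letter_of G) _ _ _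
    (fun i j : 'I_w => strip_entry G (s j) (strip_end P s i))).
- by move=> d m; exact: letter_wt_ge0.
- by move=> i j ij; apply: strip_pos_lt => //; exact: st.
- by move=> i j ij; apply: strip_pos_lt; [exact: sc|exact: h2].
move=> i j; rewrite /strip_entry; have fG := h2 i (ltn_ord i).
case: leqP => sf.
  rewrite (_ : (fun N => _) = word_sum R (expand_strip (drop (s j) (take (strip_end P s i) G)))).
    by apply: word_sum_cvg; exact: pos_strip_slice.
  apply/funext => N; rewrite trunc_col_word_sum ?expand_slice//.
  by rewrite strip_pos_le//= -strip_pos_size strip_pos_le.
rewrite (_ : (fun N => _) = fun=> 0%R); first exact: cvg_cst.
by apply/funext => N; rewrite trunc_col_lt// strip_pos_lt.
Qed.

End Strip.

(** * Skew diagrams and strips *)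

Local Open Scope fset_scope.

Section Shapes.
Local Open Scope nat_scope.
Implicit Types (la mu : seq nat).

(** The length of column j of the Young diagram; the columns of a skew diagram occupy
    the rows between two such heights. *)
Definition col_height (la : seq nat) j := count (fun m => j < m) la.

(** Lengths decrease, so the rows longer than j are the first ones. *)
Lemma nth_col_height la i j : sorted geq la -> (j < nth 0 la i) = (i < col_height la j).
Proof.
have tr : transitive geq by move=> x y z /=; lia.
elim: la i => [|x la IH] i sl /=; first by rewrite nth_nil ltn0.
have sl' : sorted geq la by exact: path_sorted sl.
have xa : all (geq x) la by move: sl; rewrite /= (path_sortedE tr) => /andP[].
rewrite /col_height /= -/(col_height la j).
have [jx|xj] := ltnP j x.
  by case: i => [|i] /=; rewrite ?IH ?add1n// jx.
have -> : col_height la j = 0.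
  apply/eqP; rewrite -leqn0 leqNgt -has_count -all_predC; apply/allP => y ya /=.
  by have := allP xa y ya; rewrite /=; lia.
rewrite addn0 ltn0.
apply/negbTE; rewrite -leqNgt; apply: leq_trans xj; case: i => //= i.
have [ia|ia] := ltnP i (size la); last by rewrite nth_default.
by have := allP xa _ (mem_nth 0 ia).
Qed.

Lemma col_height_le la j j' : j <= j' -> col_height la j' <= col_height la j.
Proof. by move=> jj; apply: sub_count => x /=; lia. Qed.

Lemma sorted_partition la : is_partition la -> sorted geq la.
Proof. by case/andP. Qed.

Lemma skew_heights la mu j : skew_pair la mu -> col_height mu j <= col_height la j.
Proof.
move=> [/sorted_partition sl /sorted_partition sm h].
case E : (col_height mu j) => [//|i].
by rewrite -nth_col_height//; apply: leq_trans (h i); rewrite nth_col_height// E.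
Qed.

Lemma mem_diagram la mu i j : skew_pair la mu ->
  ((i, j) \in skew_diagram la mu) = (col_height mu j <= i < col_height la j).
Proof.
move=> [/sorted_partition sl /sorted_partition sm h].
rewrite !inE /= [nth 0 mu i <= j]leqNgt nth_col_height// -leqNgt.
rewrite andbC; congr (_ && _).
apply/allpairsPdep/idP => [[i' [j' [_ hj [-> ->]]]]|hi].
  by rewrite -nth_col_height//; move: hj; rewrite mem_iota add0n.
exists i, j; rewrite !mem_iota !add0n /= nth_col_height//; split=> //.
by apply: leq_trans hi _; exact: count_size.
Qed.

Lemma col_rowsE la mu j : skew_pair la mu ->
  col_rows la mu j = iota (col_height mu j) (col_height la j - col_height mu j).
Proof.
move=> h; apply: (irr_sorted_eq ltn_trans ltnn).
- by apply: sorted_filter; [exact: ltn_trans|exact: iota_ltn_sorted].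
- exact: iota_ltn_sorted.
move=> i; rewrite mem_filter mem_diagram// !mem_iota.
have := count_size (fun m => j < m) la; rewrite -/(col_height la j).
have := skew_heights j h; lia.
Qed.

(** Total version of a filling, which avoids proofs of membership. *)
Definition entry (D : {fset nat * nat}) (X : Type) (x0 : X) (f : {ffun D -> X})
    (x : nat * nat) : X :=
  if insub x is Some y then f y else x0.

Lemma entry_val (D : {fset nat * nat}) (X : Type) (x0 : X) (f : {ffun D -> X}) (y : D) :
  entry x0 f (val y) = f y.
Proof. by rewrite /entry valK. Qed.

Lemma entry_in (D : {fset nat * nat}) (X : Type) (x0 : X) (f : {ffun D -> X}) x (h : x \in D) :
  entry x0 f x = f [` h].
Proof. by rewrite -(entry_val x0). Qed.

Lemma col_wordE la mu (k : filling (skew_diagram la mu) int) j : skew_pair la mu ->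
  col_word k j =
    [seq entry 0%R k (i, j) | i <- iota (col_height mu j) (col_height la j - col_height mu j)].
Proof.
move=> h; rewrite -col_rowsE// /col_word /col_rows.
elim: (iota 0 (size la)) => //= i s IH.
case: insubP => [x xD xv|/negPf->//] /=.
by rewrite xD /= IH -xv entry_val.
Qed.

Lemma size_col_word la mu (k : filling (skew_diagram la mu) int) j : skew_pair la mu ->
  size (col_word k j) = col_height la j - col_height mu j.
Proof. by move=> h; rewrite col_wordE// size_map size_iota. Qed.

Lemma nth_col_word la mu (k : filling (skew_diagram la mu) int) j d : skew_pair la mu ->
  d < col_height la j - col_height mu j ->
  nth 0%R (col_word k j) d = entry 0%R k (col_height mu j + d, j).
Proof. by move=> h hd; rewrite col_wordE// (nth_map 0) ?size_iota// nth_iota. Qed.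

Lemma expand_some ps : expand_strip [seq Some p | p <- ps] =
  [seq Some k | k <- flatten [seq piece p | p <- ps]].
Proof. by rewrite /expand_strip map_flatten -!map_comp. Qed.

Definition num_boxes (ps : seq (nat * nat)) := size (flatten [seq piece p | p <- ps]).

Lemma size_expand_some ps : size (expand_strip [seq Some p | p <- ps]) = num_boxes ps.
Proof. by rewrite expand_some size_map. Qed.

Lemma strip_pos_piece w P V G s j p : realizes w P V G s -> j < w -> p <= size (P j) ->
  strip_pos G (s j + p) = strip_pos G (s j) + num_boxes (take p (P j)).
Proof.
move=> [_ _ h3 _ _] jw hp; rewrite /strip_pos (@slice_split _ G (s j) (s j + p)) ?leq_addr//.
rewrite expand_cat size_cat -take_drop_slice -size_expand_some; congr (_ + size (expand_strip _)).
by rewrite map_take -h3// take_takel.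
Qed.

Definition shared_rows la mu j := col_height la j.+1 - col_height mu j.

(** P lists the pieces of the columns of k, and V fixes their relative position: the
    rows shared by neighbours are the boxes of the common pieces and one more, the
    row where the top box of the left column meets the end of a piece on its right. *)
Definition models la mu (k : filling (skew_diagram la mu) int) w P V :=
  [/\ forall j, w <= j -> col_height la j = col_height mu j,
      forall j, j < w -> pieces_of (col_word k j) (P j)
    & forall j, j.+1 < w ->
        shared_rows la mu j = if V j is y.+1 then (num_boxes (take y (P j))).+1 else 0].

End Shapes.

Section Bridge.
Variables (R : realType) (la mu : seq nat) (k : filling (skew_diagram la mu) int).
Variables (w : nat) (P : nat -> seq (nat * nat)) (V s : nat -> nat).
Variable (G : seq (option (nat * nat))).
Hypotheses (hlm : skew_pair la mu) (hk : models k w P V).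
Hypotheses (hlink : link_ok w P V) (hG : realizes w P V G s).
Local Open Scope nat_scope.

Local Notation T := (col_height mu).
Local Notation B := (col_height la).
Local Notation D := (skew_diagram la mu).
Let t j := strip_pos G (s j).
Let c j := strip_pos G (strip_end P s j).

Lemma num_boxes_col j : j < w -> num_boxes (P j) = B j - T j.
Proof. by move=> jw; have [_ h _] := hk; have [_ e] := h j jw;
  rewrite -(size_col_word k)// e. Qed.

Lemma strip_pos_end j : j < w -> c j = t j + (B j - T j).
Proof.
move=> jw; rewrite /c /t /strip_end (strip_pos_piece hG)// take_size.
by rewrite num_boxes_col.
Qed.

Lemma strip_letter j d : j < w -> d < B j - T j ->
  nth None (expand_strip G) (t j + d) = Some (entry 0%R k (T j + d, j)).
Proof.
move=> jw hd; have [_ h2 h3 _ _] := hG; have [_ h _] := hk; have [_ e] := h j jw.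
have := expand_slice (leq_addr _ _ : s j <= strip_end P s j) (h2 j jw).
rewrite -take_drop_slice h3// expand_some -e => E.
have := congr1 (fun X => nth None X d) E.
rewrite nth_drop nth_take -/(t j); last by rewrite -/(c j) strip_pos_end//; lia.
move=> ->; rewrite (nth_map 0%R) ?size_col_word//.
by rewrite nth_col_word.
Qed.

(** The diagonals of the strip place neighbouring columns as the rows of the diagram
    do, except that disconnected columns come as close as possible. *)
Lemma strip_shared j : j.+1 < w -> t j + shared_rows la mu j = (c j.+1).+1.
Proof.
move=> jw; have [_ h2 h3 h4 h5] := hG; have [_ _ ->] := hk => //.
have hs := h4 j jw; have hN := h5 j jw; have := h2 j (ltnW jw).
case E : (V j) hs hN => [|y] hs hN fG.
  rewrite addn0 in hs; rewrite addn0 /t hs /c /strip_pos.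
  rewrite (take_nth None); last by rewrite -hs (leq_trans _ fG)// leq_addr.
  by rewrite hN// -cats1 expand_cat size_cat addn1.
have [hy _ _] := hlink jw; rewrite E in hy.
have e : strip_end P s j.+1 = s j + y by lia.
by rewrite addnS /c e (strip_pos_piece hG (ltnW jw))// ltnW.
Qed.

Lemma box_col i j : (i, j) \in D -> j < w.
Proof.
rewrite mem_diagram// => h; rewrite ltnNge; apply/negP => wj.
by have [e _ _] := hk; have := e j wj; lia.
Qed.

(** The filling transported to the diagonals of the strip. *)
Definition tab_of (M : {ffun D -> nat}) : 'I_w -> nat -> nat := fun j d =>
  if t j <= d < c j then entry 0 M (T j + (d - t j), nat_of_ord j) else 0.

Lemma tab_of_box M (j : 'I_w) i (h : (i, nat_of_ord j) \in D) :
  tab_of M j (t j + (i - T j)) = M [` h].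
Proof.
rewrite /tab_of strip_pos_end//; have := h; rewrite mem_diagram// => h'.
rewrite ifT; last by lia.
have -> : T j + (t j + (i - T j) - t j) = i by lia.
by rewrite entry_in.
Qed.

Lemma in_strip_box (j : 'I_w) d : t j <= d < c j ->
  (T j + (d - t j), nat_of_ord j) \in D.
Proof. by rewrite strip_pos_end// mem_diagram//; lia. Qed.

Lemma tab_of_strip M (j : 'I_w) d (h : t j <= d < c j) :
  tab_of M j d = M [` in_strip_box h].
Proof. by rewrite /tab_of {1}h (entry_in _ _ (in_strip_box h)). Qed.

Lemma tab_of_ssyt (M : {ffun D -> nat}) : ssyt M ->
  strip_tab (fun j : 'I_w => t j) (fun j : 'I_w => c j) (tab_of M).
Proof.
move=> [M0 Mr Mc]; split.
- by move=> j /=; rewrite strip_pos_end// leq_addr.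
- move=> j d /=; case: (boolP (t j <= d < c j)) => h; first by rewrite tab_of_strip M0.
  by rewrite /tab_of (negPf h).
- move=> j d /= td dc.
  have h : t j <= d < c j by lia.
  have h' : t j <= d.+1 < c j by lia.
  by rewrite !tab_of_strip; apply: Mc => //; rewrite /row_of /=; lia.
- move=> i j d ij /= hi hj; rewrite !tab_of_strip; apply: Mr; rewrite /row_of /col_of /=;
  last by lia.
  have iw : i.+1 < w by rewrite -ij.
  have := strip_shared iw; rewrite -ij /shared_rows -ij.
  by have := @strip_pos_end i (ltn_ord i); have := @strip_pos_end j (ltn_ord j); lia.
Qed.

Definition untab (N : 'I_w -> nat -> nat) : {ffun D -> nat} :=
  [ffun x => if insub (col_of x) is Some j then N j (t j + (row_of x - T j)) else 0].

Lemma untabE N i (j : 'I_w) (h : (i, nat_of_ord j) \in D) :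
  untab N [` h] = N j (t j + (i - T j)).
Proof.
rewrite ffunE /col_of /row_of /=; case: insubP => [j' _ e|]; last by rewrite ltn_ord.
by have -> : j' = j by apply: val_inj.
Qed.

Lemma untabK N : strip_tab (fun j : 'I_w => t j) (fun j : 'I_w => c j) N ->
  tab_of (untab N) = N.
Proof.
move=> [_ /= hN _ _]; apply/funext => j; apply/funext => d.
case: (boolP (t j <= d < c j)) => h.
  by rewrite tab_of_strip untabE; congr (N _ _); lia.
rewrite /tab_of (negPf h); have := hN j d; rewrite (negPf h); lia.
Qed.

Lemma tab_of_inj M M' : tab_of M = tab_of M' -> M = M'.
Proof.
move=> e; apply/ffunP => -[[i j] h].
have jw := box_col h; pose j' := Ordinal jw.
have := congr1 (fun f => f j' (t j' + (i - T j'))) e.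
by rewrite !(@tab_of_box _ j' i h).
Qed.

(** Only adjacent columns are compared in a strip; boxes of one row further apart are
    compared through the boxes between them, which exist in a skew diagram. *)
Lemma untab_ssyt N : strip_tab (fun j : 'I_w => t j) (fun j : 'I_w => c j) N ->
  ssyt (untab N).
Proof.
move=> [/= hc h0 hcol hrow].
have col (j : 'I_w) d d' : t j <= d -> d < d' -> d' < c j -> N j d < N j d'.
  move=> td; elim: d' => // d' IH; rewrite ltnS leq_eqVlt => /predU1P[<-|dd] dc.
    exact: hcol.
  by apply: ltn_trans (IH dd _) (hcol _ _ _ _) => //; lia.
have row i (j : 'I_w) n (jn : j + n < w) : (i, nat_of_ord j) \in D -> (i, j + n) \in D ->
   N j (t j + (i - T j)) <= N (Ordinal jn) (t (j + n) + (i - T (j + n))).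
  elim: n jn => [|n IH] jn hj hn.
    have -> : Ordinal jn = j by apply: val_inj; rewrite /= addn0.
    by rewrite addn0.
  have jn' : j + n < w by lia.
  have hm : (i, j + n) \in D.
    move: hj hn; rewrite !mem_diagram//.
    have := col_height_le mu (leq_addr n j); have := col_height_le la (leq_addr n j).
    have := col_height_le la (_ : j + n <= j + n.+1); have :=
      col_height_le mu (_ : j + n <= j + n.+1).
    lia.
  apply: leq_trans (IH jn' hj hm) _.
  have iw : (j + n).+1 < w by lia.
  have := strip_shared iw; rewrite /shared_rows -addnS.
  have := @strip_pos_end _ jn'; have := @strip_pos_end _ jn.
  move: hm hn; rewrite !mem_diagram// => hm hn e1 e2 e3.
  have -> : t (j + n) + (i - T (j + n)) = (t (j + n.+1) + (i - T (j + n.+1))).+1 by lia.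
  by apply: hrow => /=; lia.
split.
- move=> [[i j] h]; have jw := box_col h; rewrite (@untabE N i (Ordinal jw) h) h0 /=.
  by move: (h); rewrite strip_pos_end// mem_diagram//; lia.
- move=> [[i j] h] [[i' j'] h']; rewrite /row_of /col_of /= => ii jj; subst i'.
  have jw := box_col h; have jw' := box_col h'.
  rewrite (@untabE N i (Ordinal jw) h) (@untabE N i (Ordinal jw') h') /=.
  have jn : j + (j' - j) < w by lia.
  have hn : (i, j + (j' - j)) \in D by rewrite subnKC// ltnW.
  have := @row i (Ordinal jw) _ jn h hn.
  have e : j + (j' - j) = j' by lia.
  have -> : Ordinal jn = Ordinal jw' by apply: val_inj.
  by rewrite /= e.
- move=> [[i j] h] [[i' j'] h']; rewrite /row_of /col_of /= => jj ii; subst j'.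
  have jw := box_col h.
  rewrite (@untabE N i (Ordinal jw) h) (@untabE N i' (Ordinal jw) h') /=.
  move: (h) (h'); rewrite !mem_diagram// => hi hi'.
  by apply: col => /=; rewrite ?strip_pos_end//; lia.
Qed.

Lemma tab_of_bij : set_bij [set M : {ffun D -> nat} | ssyt M]
  (strip_tabs (fun j : 'I_w => t j) (fun j : 'I_w => c j)) tab_of.
Proof.
split.
- by move=> M; exact: tab_of_ssyt.
- by move=> M M' _ _; exact: tab_of_inj.
- by move=> N hN; exists (untab N); [exact: untab_ssyt|exact: untabK].
Qed.

Lemma boxes_perm : perm_eq D [seq (i, j) | j <- iota 0 w, i <- iota (T j) (B j - T j)].
Proof.
apply: uniq_perm; first exact: fset_uniq.
  apply: allpairs_uniq_dep; first exact: iota_uniq.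
    by move=> j _; exact: iota_uniq.
  by move=> [j i] [j' i'] _ _ /= [-> ->].
move=> [i j]; rewrite mem_diagram//; apply/idP/allpairsPdep => [h|[j' [i' [_ h [-> ->]]]]].
  exists j, i; split=> //; rewrite mem_iota ?add0n; last by lia.
  by apply: (@box_col i); rewrite mem_diagram.
by move: h; rewrite mem_iota; lia.
Qed.

Lemma tab_of_wt (M : {ffun D -> nat}) :
  (\prod_(x : D) (M x)%:R ^ (- k x) =
   strip_wt (letter_of R G) (fun j : 'I_w => t j) (fun j : 'I_w => c j) (tab_of M))%R.
Proof.
pose F x : R := ((entry 0 M x)%:R ^ (- entry 0 k x))%R.
transitivity (\prod_(x <- D) F x)%R.
  by rewrite big_seq_fsetE /=; apply: eq_bigr => x _; rewrite /F !entry_val.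
rewrite (perm_big _ boxes_perm) /= big_allpairs_dep /=.
rewrite -{1}[w]subn0 -/(index_iota 0 w) big_mkord; apply: eq_bigr => j _.
rewrite strip_pos_end// /index_iota addKn.
have E m n : iota m n = map (addn m) (iota 0 n) by rewrite -iotaDl addn0.
rewrite [iota (T j) _]E [iota (t j) _]E !big_map big_seq [RHS]big_seq.
apply: eq_bigr => d; rewrite mem_iota add0n => /= hd.
have hb : (T j + d, nat_of_ord j) \in D by rewrite mem_diagram//; lia.
rewrite /letter_of strip_letter//= /F (entry_in _ _ hb); congr ((_%:R) ^ _)%R.
rewrite -(tab_of_box M hb); congr (tab_of M j _); lia.
Qed.

(** The Jacobi-Trudi formula for skew shapes that satisfy the compatibility of
    columns expressed by [models] and [realizes]. *)
Lemma schur_zeta_det : schur_zeta R k = (\det (strip_mx R w P G s))%:E.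
Proof.
rewrite -(strip_zeta R hlink hG) (@reindex_esum _ _ _ _ _ _ _ tab_of_bij).
by apply: eq_esum => M _; rewrite tab_of_wt.
Qed.

End Bridge.

(** * Columns of a tableau and their pieces *)

Section Pieces.
Local Open Scope nat_scope.
Implicit Types (ps qs : seq (nat * nat)).

Definition unpieces ps : seq int := flatten [seq piece p | p <- ps].

Lemma size_piece p : 0 < p.1 -> size (piece p) = p.1.
Proof. by move=> h; rewrite size_rcons size_nseq prednK. Qed.

Lemma num_boxes_cons p ps : num_boxes (p :: ps) = size (piece p) + num_boxes ps.
Proof. by rewrite /num_boxes /= size_cat. Qed.

Lemma num_boxes_cat ps qs : num_boxes (ps ++ qs) = num_boxes ps + num_boxes qs.
Proof. by rewrite /num_boxes map_cat flatten_cat size_cat. Qed.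

Lemma num_boxes_split n ps : num_boxes ps = num_boxes (take n ps) + num_boxes (drop n ps).
Proof. by rewrite -num_boxes_cat cat_take_drop. Qed.

Lemma num_boxes_sumn ps : pos_pieces ps -> num_boxes ps = sumn [seq p.1 | p <- ps].
Proof.
elim: ps => //= p ps IH /andP[/andP[a _] h].
by rewrite num_boxes_cons size_piece// IH.
Qed.

Lemma num_boxes_gt0 ps : (0 < num_boxes ps) = (0 < size ps).
Proof. by case: ps => // p ps; rewrite num_boxes_cons size_rcons. Qed.

Lemma pos_pieces_take n ps : pos_pieces ps -> pos_pieces (take n ps).
Proof. by move=> h; apply/allP => p /mem_take; exact: (allP h). Qed.

Lemma pos_pieces_drop n ps : pos_pieces ps -> pos_pieces (drop n ps).
Proof. by move=> h; apply/allP => p /mem_drop; exact: (allP h). Qed.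

Lemma pos_pieces_dual ps : pos_pieces ps -> pos_pieces (dual_pieces ps).
Proof.
move=> h; rewrite /pos_pieces all_map all_rev; apply/allP => p /(allP h) /=.
by rewrite andbC.
Qed.

(** A letter other than 1 can only be the last one of its piece. *)
Lemma piece_boundary ps m : 0 < m <= num_boxes ps ->
  nth 0%R (unpieces ps) m.-1 <> 1%R -> exists2 n, n <= size ps & num_boxes (take n ps) = m.
Proof.
rewrite /unpieces; elim: ps m => [|p ps IH] m /=; first by rewrite /num_boxes /=; lia.
rewrite num_boxes_cons nth_cat => hm.
have [hp|hp] := ltnP m.-1 (size (piece p)).
  rewrite /piece nth_rcons size_nseq nth_nseq => h.
  have : p.1.-1 <= m.-1.
    by rewrite leqNgt; apply/negP => hlt; rewrite hlt in h.
  move: hp; rewrite /piece size_rcons size_nseq => hp hm'.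
  by exists 1; rewrite //= take0 /num_boxes /= cats0 size_rcons size_nseq; lia.
move=> h; have [||n hn e] := IH (m - size (piece p)); first by lia.
  by have -> : (m - size (piece p)).-1 = m.-1 - size (piece p) by lia.
exists n.+1; rewrite //= num_boxes_cons e; lia.
Qed.

Lemma ones_cat_inj (m n : nat) (x y : int) (u v : seq int) : x <> 1%R -> y <> 1%R ->
  nseq m 1%R ++ x :: u = nseq n 1%R ++ y :: v -> [/\ m = n, x = y & u = v].
Proof.
move=> hx hy; elim: m n => [|m IH] [|n] //= [].
- by move=> -> ->.
- by move=> e; rewrite e in hx.
- by move=> e; rewrite -e in hy.
- by move=> /IH[-> -> ->].
Qed.

Lemma piece_cat p w : piece p ++ w = nseq p.1.-1 1%R ++ (p.2.+1%:Z)%R :: w.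
Proof. by rewrite /piece cat_rcons. Qed.

(** Uniqueness of the decomposition into pieces, in a form that also compares a word
    with a longer one. *)
Lemma unpieces_prefix ps qs r : pos_pieces ps -> pos_pieces qs ->
  unpieces qs = unpieces ps ++ r -> take (size ps) qs = ps.
Proof.
rewrite /unpieces; elim: ps qs => [|[a b] ps IH] qs /=; first by rewrite take0.
case: qs => [|[c d] qs] /=;
  first by case: (piece _ ++ _) (size_cat (piece (a, b)) (flatten [seq piece p | p <- ps])) =>
    //=; rewrite size_rcons.
move=> /andP[/andP[/= a0 b0] h] /andP[/andP[/= c0 d0] h'].
rewrite -catA !piece_cat /= => /ones_cat_inj[||e1 [e2] e3].
- by move=> [?]; lia.
- by move=> [?]; lia.
by rewrite (IH qs)//; congr ((_, _) :: _); lia.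
Qed.

Lemma piece_rows_iota m ps p : pos_pieces ps -> p < size ps ->
  piece_rows (iota m (num_boxes ps)) ps p = iota (m + num_boxes (take p ps)) (nth (0, 0) ps p).1.
Proof.
move=> h hp; rewrite /piece_rows nth_reshape (nth_map (0, 0))// -map_take.
rewrite -num_boxes_sumn; last exact: pos_pieces_take.
rewrite drop_iota take_iota; congr iota.
apply/minn_idPl; rewrite {1}(num_boxes_split p ps) addKn (drop_nth (0, 0))// num_boxes_cons.
rewrite size_piece ?leq_addr//.
by have := allP h _ (mem_nth (0, 0) hp) => /andP[].
Qed.

Lemma num_boxes_takeS ps p : pos_pieces ps -> p < size ps ->
  num_boxes (take p.+1 ps) = num_boxes (take p ps) + (nth (0, 0) ps p).1.
Proof.
move=> h hp; rewrite (take_nth (0, 0))// -cats1 num_boxes_cat num_boxes_cons addn0 size_piece//.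
by have := allP h _ (mem_nth (0, 0) hp) => /andP[].
Qed.

Lemma nth_pos_pieces ps p : pos_pieces ps -> p < size ps -> 0 < (nth (0, 0) ps p).1.
Proof. by move=> h hp; have := allP h _ (mem_nth (0, 0) hp) => /andP[]. Qed.

Lemma top_rowE m ps p : pos_pieces ps -> p < size ps ->
  top_row (iota m (num_boxes ps)) ps p = m + num_boxes (take p ps).
Proof.
move=> h hp; rewrite /top_row piece_rows_iota//; have := nth_pos_pieces h hp.
by case: (nth _ _ _).1.
Qed.

Lemma bot_rowE m ps p : pos_pieces ps -> p < size ps ->
  (bot_row (iota m (num_boxes ps)) ps p).+1 = m + num_boxes (take p.+1 ps).
Proof.
move=> h hp; rewrite /bot_row piece_rows_iota// num_boxes_takeS//; have := nth_pos_pieces h hp.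
by case: (nth _ _ _).1 => // a _; rewrite -nth_last size_iota nth_iota //=; lia.
Qed.

End Pieces.

Section Data.
Local Open Scope nat_scope.
Variables (la mu : seq nat) (k : filling (skew_diagram la mu) int).
Variable (P : nat -> seq (nat * nat)).
Hypotheses (hlm : skew_pair la mu) (hID : in_ID k).
Hypothesis hP : forall j, pieces_of (col_word k j) (P j).
Local Notation T := (col_height mu).
Local Notation B := (col_height la).

Lemma num_boxes_height j : num_boxes (P j) = B j - T j.
Proof. by have [_ e] := hP j; rewrite -(size_col_word k)// e. Qed.

(** The box to the right of the top box of column j carries a letter other than 1, so
    it ends a piece of column j + 1.  What follows it there repeats, by constancy
    along diagonals, the beginning of column j, and decompositions are unique. *)
Lemma overlap_exists j : 0 < shared_rows la mu j -> exists y,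
  [/\ y < size (P j), y < size (P j.+1), (num_boxes (take y (P j))).+1 = shared_rows la mu j
    & drop (size (P j.+1) - y) (P j.+1) = take y (P j)].
Proof.
rewrite /shared_rows => v0; have [hdiag _ htop] := hID.
have hT := col_height_le mu (leqnSn j); have hB := col_height_le la (leqnSn j).
have [p1 e1] : pos_pieces (P j) /\ col_word k j = unpieces (P j) := hP j.
have [p2 e2] : pos_pieces (P j.+1) /\ col_word k j.+1 = unpieces (P j.+1) := hP j.+1.
have xD : (T j, j) \in skew_diagram la mu by rewrite mem_diagram//; lia.
have yD : (T j, j.+1) \in skew_diagram la mu by rewrite mem_diagram//; lia.
(* The letter beside the top box of column j has index T j - T j.+1 in column j + 1. *)
have ne : nth 0%R (unpieces (P j.+1)) (T j - T j.+1).+1.-1 <> 1%R.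
  rewrite -e2 nth_col_word//=; last by lia.
  rewrite subnKC// (entry_in _ _ yD); apply: (htop [` xD]) => // -[[i' j'] h] /=.
  by rewrite /col_of /row_of /= => ?; subst j'; move: h; rewrite mem_diagram//; lia.
have [|n hn en] := piece_boundary _ ne; first by rewrite num_boxes_height; lia.
have n0 : 0 < n by case: n en {hn} => //; rewrite take0.
pose y := size (P j.+1) - n.
have ly : num_boxes (drop n (P j.+1)) = (B j.+1 - T j).-1.
  by have := num_boxes_split n (P j.+1); rewrite num_boxes_height en; lia.
have pre : unpieces (P j) = unpieces (drop n (P j.+1)) ++ drop (B j.+1 - T j).-1 (unpieces (P j)).
  rewrite -{1}(cat_take_drop (B j.+1 - T j).-1 (unpieces (P j))); congr (_ ++ _).
  have -> : unpieces (drop n (P j.+1)) = drop (T j - T j.+1).+1 (unpieces (P j.+1)).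
    by rewrite -{2}(cat_take_drop n (P j.+1)) /unpieces map_cat flatten_cat drop_size_cat.
  rewrite -e1 -e2; apply: (@eq_from_nth _ 0%R).
    by rewrite size_take size_drop !size_col_word//; case: ifP; lia.
  move=> d; rewrite size_take size_col_word// => hd.
  have {}hd : d < (B j.+1 - T j).-1 by move: hd; case: ifP; lia.
  rewrite nth_take// nth_drop !nth_col_word//; [|lia..].
  have h1 : (T j + d, j) \in skew_diagram la mu by rewrite mem_diagram//; lia.
  have h2 : (T j.+1 + ((T j - T j.+1).+1 + d), j.+1) \in skew_diagram la mu.
    by rewrite mem_diagram//; lia.
  rewrite (entry_in _ _ h1) (entry_in _ _ h2); apply: hdiag; rewrite /col_of /row_of /=.
  have -> : T j.+1 + ((T j - T j.+1).+1 + d) = (T j + d).+1 by lia.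
  by lia.
have hY := unpieces_prefix (pos_pieces_drop n p2) p1 pre.
rewrite size_drop -/y in hY.
exists y; rewrite hY ly; split=> //; try by lia.
- rewrite ltnNge; apply/negP => hy.
  have := ly; rewrite -hY take_oversize// num_boxes_height; lia.
- by rewrite subKn.
Qed.

Lemma links_exist : exists V, link_ok (head 0 la) P V /\ models k (head 0 la) P V.
Proof.
have /choice[V hV] : forall j, exists v, if v is y.+1 then
    [/\ y < size (P j), y < size (P j.+1), (num_boxes (take y (P j))).+1 = shared_rows la mu j
    & drop (size (P j.+1) - y) (P j.+1) = take y (P j)] else shared_rows la mu j = 0.
  move=> j; have [v0|/overlap_exists[y hy]] := posnP (shared_rows la mu j); first by exists 0.
  by exists y.+1.
exists V; split.
  by move=> j _; have := hV j; case: (V j) => // y [] *; split.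
split=> // [j wj|j jw].
  have : col_height la j = 0.
    apply/eqP; rewrite -leqn0 leqNgt -nth_col_height ?nth0 -?leqNgt//.
    by case: hlm => /sorted_partition.
  by have := skew_heights j hlm; lia.
by have := hV j; case: (V j) => // y [].
Qed.

End Data.

(** * The dual tableau and its strip *)

Section DualData.
Local Open Scope nat_scope.

Lemma take_dual_pieces n (ps : seq (nat * nat)) : n <= size ps ->
  take n (dual_pieces ps) = dual_pieces (drop (size ps - n) ps).
Proof. by move=> h; rewrite /dual_pieces -map_take take_rev. Qed.

Lemma drop_dual_pieces n (ps : seq (nat * nat)) :
  drop n (dual_pieces ps) = dual_pieces (take (size ps - n) ps).
Proof. by rewrite /dual_pieces -map_drop drop_rev. Qed.

Lemma dual_link_ok w P V : link_ok w P V -> link_ok w (dual_cols w P) (dual_links w V).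
Proof.
move=> h j jw; rewrite /dual_cols /dual_links !size_dual_pieces.
have -> : w.-1 - j = (w.-2 - j).+1 by lia.
have -> : w.-1 - j.+1 = w.-2 - j by lia.
have [|h1 h2 h3] := h (w.-2 - j); first by lia.
split=> // V0; rewrite take_dual_pieces; last by lia.
by rewrite h3// drop_dual_pieces subKn//; lia.
Qed.

Lemma shared_rows_eq0l la mu j : col_height la j = col_height mu j ->
  shared_rows la mu j = 0.
Proof. by have := col_height_le la (leqnSn j); rewrite /shared_rows; lia. Qed.

Lemma shared_rows_eq0r la mu j : col_height la j.+1 = col_height mu j.+1 ->
  shared_rows la mu j = 0.
Proof. by have := col_height_le mu (leqnSn j); rewrite /shared_rows; lia. Qed.

Variables (la mu : seq nat) (k : filling (skew_diagram la mu) int).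
Variable (P : nat -> seq (nat * nat)) (V : nat -> nat).
Hypotheses (hlm : skew_pair la mu).
Local Notation w := (head 0 la).
Hypothesis hP : forall j, pieces_of (col_word k j) (P j).
Hypotheses (hL : link_ok w P V) (hM : models k w P V).

Lemma pos_pieces_col j : pos_pieces (P j). Proof. by have [] := hP j. Qed.

Lemma col_rows_boxes j : col_rows la mu j = iota (col_height mu j) (num_boxes (P j)).
Proof. by rewrite (num_boxes_height hlm hP) col_rowsE. Qed.

Lemma col_nonempty j : (col_rows la mu j != [::]) = (0 < size (P j)).
Proof.
by rewrite col_rows_boxes -num_boxes_gt0; case: (num_boxes _).
Qed.

Lemma col_width j : 0 < size (P j) -> j < w.
Proof.
move=> h; rewrite ltnNge; apply/negP => wj.
have [/(_ j wj) e _ _] := hM.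
by move: h; rewrite -num_boxes_gt0 (num_boxes_height hlm hP) e subnn.
Qed.

Lemma link_eq0 j : j.+1 < w -> (V j == 0) = (shared_rows la mu j == 0).
Proof. by have [_ _ h] := hM => /h->; case: (V j). Qed.

Lemma top_bot_shared j p q : p < size (P j) -> q < size (P j.+1) ->
  top_row (col_rows la mu j) (P j) p = bot_row (col_rows la mu j.+1) (P j.+1) q ->
  0 < shared_rows la mu j.
Proof.
move=> hp hq; rewrite !col_rows_boxes => e.
have := bot_rowE (col_height mu j.+1) (pos_pieces_col _) hq;
  rewrite -e top_rowE ?pos_pieces_col//.
have := num_boxes_split q.+1 (P j.+1); rewrite (num_boxes_height hlm hP).
have := skew_heights j.+1 hlm.
by rewrite /shared_rows; lia.
Qed.

(** Where neighbours are connected, the bottom piece of column j + 1 shares its first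
    index with a piece of column j, and the prescribed rows of their duals give the
    overlap of the dual columns.  Otherwise no first index is common, since equal
    first indices would give the columns a common row, and the duals are placed in
    disjoint rows. *)
Lemma dual_models la' mu' (k' : filling (skew_diagram la' mu') int) n :
  skew_pair la' mu' -> labelling la mu P n ->
  (forall j, j < w -> pieces_of (col_word k' (w.-1 - j)) (dual_pieces (P j))) ->
  (forall c, w <= c -> col_rows la' mu' c = [::]) ->
  (forall j p q, p < size (P j.+1) -> q < size (P j) -> n j.+1 + p = n j + q ->
    top_row (col_rows la' mu' (w.-1 - j.+1)) (dual_pieces (P j.+1)) ((size (P j.+1)).-1 - p)
    = bot_row (col_rows la' mu' (w.-1 - j)) (dual_pieces (P j)) ((size (P j)).-1 - q)) ->
  (forall j' j, next_col la mu j' j ->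
     (forall p q, p < size (P j) -> q < size (P j') -> n j + p <> n j' + q) ->
     forall r s, r \in col_rows la' mu' (w.-1 - j') -> s \in col_rows la' mu' (w.-1 - j) ->
       r < s) ->
  models k' w (dual_cols w P) (dual_links w V).
Proof.
move=> hlm' [_ _ hn _] hD hw hconn hdisc.
have hD' j : j < w -> pieces_of (col_word k' j) (dual_cols w P j).
  by move=> jw; have := hD (w.-1 - j); rewrite subKn; [apply; lia|lia].
have hlet j : j < w -> num_boxes (dual_cols w P j) = col_height la' j - col_height mu' j.
  by move=> jw; have [_ e] := hD' j jw; rewrite -(size_col_word k')// e.
split=> // [c wc|j jw].
  have := hw c wc; rewrite col_rowsE//; have := skew_heights c hlm'.
  by case E : (_ - _) => [|//]; lia.
set i := w.-2 - j; have iw : i.+1 < w by rewrite /i; lia.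
have ei : w.-1 - j = i.+1 by rewrite /i; lia.
have ei' : w.-1 - j.+1 = i by rewrite /i; lia.
have wi : w.-1 - i.+1 = j by rewrite /i; lia.
have wi' : w.-1 - i = j.+1 by rewrite /i; lia.
have d1 : dual_cols w P j = dual_pieces (P i.+1) by rewrite /dual_cols ei.
have d2 : dual_cols w P j.+1 = dual_pieces (P i) by rewrite /dual_cols ei'.
have l1 := hlet j (ltnW jw); have l2 := hlet j.+1 jw.
have r1 : col_rows la' mu' j = iota (col_height mu' j) (num_boxes (dual_cols w P j)).
  by rewrite l1 col_rowsE.
have r2 : col_rows la' mu' j.+1 = iota (col_height mu' j.+1) (num_boxes (dual_cols w P j.+1)).
  by rewrite l2 col_rowsE.
have h1 := skew_heights j hlm'; have h2 := skew_heights j.+1 hlm'.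
have [_ _ /(_ i iw)] := hM.
rewrite {1}/dual_links -/i.
have [hy1 hy2 hy3] := hL iw.
case E : (V i) hy1 hy2 hy3 => [|y] hy1 hy2 hy3 hsh.
  have [s1|s1] := posnP (size (P i.+1)).
    by apply: shared_rows_eq0l; move: l1; rewrite d1 (size0nil s1) /num_boxes /=; lia.
  have [s2|s2] := posnP (size (P i)).
    by apply: shared_rows_eq0r; move: l2; rewrite d2 (size0nil s2) /num_boxes /=; lia.
  have nx : next_col la mu i i.+1.
    by split; rewrite ?col_nonempty// => c; lia.
  have g1 : 0 < num_boxes (dual_cols w P j) by rewrite num_boxes_gt0 d1 size_dual_pieces.
  have g2 : 0 < num_boxes (dual_cols w P j.+1) by rewrite num_boxes_gt0 d2 size_dual_pieces.
  have : (col_height la' j.+1).-1 < col_height mu' j.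
    apply: (hdisc _ _ nx); rewrite ?wi ?wi' ?r1 ?r2 ?mem_iota; [|lia..].
    move=> p q hp hq e; have := @top_bot_shared i q p hq hp.
    by rewrite hsh => /(_ ((hn i q p hq hp).1 (esym e))).
  by rewrite /shared_rows; lia.
have {}hy3 := hy3 isT; rewrite /= in hy3.
(* The piece of column i + 1 that ends beside the top box of column i. *)
pose p0 := (size (P i.+1) - y).-1.
have hp0 : p0 < size (P i.+1) by rewrite /p0; lia.
have ep0 : p0.+1 = size (P i.+1) - y by rewrite /p0; lia.
have t0 : top_row (col_rows la mu i) (P i) 0 = bot_row (col_rows la mu i.+1) (P i.+1) p0.
  apply: succn_inj;
    rewrite !col_rows_boxes bot_rowE ?pos_pieces_col// top_rowE ?pos_pieces_col//; last by lia.
  rewrite take0 ep0 /num_boxes /= addn0 -/(num_boxes _).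
  have := num_boxes_split (size (P i.+1) - y) (P i.+1); rewrite hy3 (num_boxes_height hlm hP).
  by move: hsh; have := skew_heights i.+1 hlm; rewrite /shared_rows; lia.
have hi0 : 0 < size (P i) by lia.
have en : n i.+1 + (size (P i.+1)).-1 = n i + y.
  by have := (hn i 0 p0 hi0 hp0).2 t0; rewrite /p0; lia.
have H : top_row (col_rows la' mu' (w.-1 - i.+1)) (dual_pieces (P i.+1)) 0
    = bot_row (col_rows la' mu' (w.-1 - i)) (dual_pieces (P i)) ((size (P i)).-1 - y).
  by rewrite -(hconn i _ y _ _ en) ?subnn//; lia.
have pd x : pos_pieces (dual_pieces (P x)) by apply: pos_pieces_dual; exact: pos_pieces_col.
move/(congr1 S): H; rewrite wi wi' r1 r2 d1 d2 bot_rowE ?size_dual_pieces//; last by lia.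
rewrite top_rowE ?size_dual_pieces//; last by lia.
rewrite take0 {1}/num_boxes /= addn0.
have -> : ((size (P i)).-1 - y).+1 = size (P i) - y by move: hy1; clear; lia.
move: l1 l2; rewrite d1 d2 => l1 l2 H.
have := num_boxes_split (size (P i) - y) (dual_pieces (P i)).
rewrite drop_dual_pieces subKn; last by lia.
rewrite [take y (dual_pieces _)]take_dual_pieces; last by lia.
rewrite hy3 /shared_rows l2; move: H h2; clear; lia.
Qed.

End DualData.

Section Heights.
Local Open Scope nat_scope.

(** The conjugate partition. *)
Lemma heights_partition w (h : nat -> nat) : (forall j, j.+1 < w -> h j.+1 <= h j) ->
  exists la, is_partition la /\ forall j, col_height la j = if j < w then h j else 0.
Proof.
move=> hd.
have mono i j : i <= j -> j < w -> h j <= h i.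
  move=> /subnK <-; elim: (j - i) => // n IH /= nw.
  by apply: leq_trans (hd _ nw) (IH _); rewrite addSn in nw; exact: ltnW.
pose g i := count (fun j => i < h j) (iota 0 w).
have gE i j : (j < g i) = (j < w) && (i < h j).
  have [jw|wj] := ltnP j w; last first.
    by apply/negbTE; rewrite -leqNgt; apply: leq_trans wj;
      rewrite -[w in _ <= w](size_iota 0) count_size.
  have -> : g i =
    count (fun j => i < h j) (iota 0 j.+1) + count (fun j => i < h j) (iota j.+1 (w - j.+1)).
    by rewrite -count_cat -iotaD subnKC.
  have [ih|hi] := ltnP i (h j).
    have -> : count (fun j => i < h j) (iota 0 j.+1) = j.+1.
      rewrite -[RHS](size_iota 0); apply/eqP; rewrite -all_count; apply/allP => x.
      by rewrite mem_iota => hx; apply: leq_trans ih _; apply: mono; lia.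
    by lia.
  have -> : iota 0 j.+1 = iota 0 j ++ [:: j] by rewrite -[j.+1]addn1 iotaD.
  apply/negbTE; rewrite -leqNgt count_cat /= ltnNge hi !addn0.
  rewrite [X in _ + X](_ : _ = 0) ?addn0.
    by rewrite -[X in _ <= X](size_iota 0) count_size.
  apply/eqP; rewrite -leqn0 leqNgt -has_count -all_predC; apply/allP => x.
  rewrite mem_iota /= -leqNgt => hx; apply: leq_trans hi; apply: mono; lia.
(* The number of rows is the height of the first column; for w = 0 there is none. *)
pose m := if 0 < w then h 0 else 0.
exists (mkseq g m); split.
  apply/andP; split.
    rewrite /mkseq sorted_map; apply: (sub_sorted (e := ltn)); last exact: iota_ltn_sorted.
    move=> a b ab; rewrite /= leqNgt; apply/negP => lt.
    by have := gE b (g a); have := gE a (g a); rewrite lt ltnn; lia.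
  apply/mapP => -[i]; rewrite mem_iota /m => hi e.
  by have := gE i 0; rewrite -e; move: hi; case: ifP; lia.
move=> j; rewrite /col_height /mkseq count_map.
have E : (preim g (fun x => j < x)) =1 (fun i => (j < w) && (i < h j)) by move=> i /=.
rewrite (eq_count E); case: ltnP => jw; last by rewrite count_pred0.
have hm : h j <= m by rewrite /m (leq_ltn_trans _ jw)//; exact: mono.
rewrite -(subnKC hm) iotaD count_cat add0n.
rewrite [X in _ + X](_ : _ = 0) ?addn0.
  rewrite -[RHS](size_iota 0); apply/eqP; rewrite -all_count; apply/allP => x.
  by rewrite mem_iota.
apply/eqP; rewrite -leqn0 leqNgt -has_count -all_predC; apply/allP => x.
by rewrite mem_iota /=; lia.
Qed.

Lemma skew_heights_exist w (t b : nat -> nat) :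
  (forall j, j.+1 < w -> t j.+1 <= t j) -> (forall j, j.+1 < w -> b j.+1 <= b j) ->
  (forall j, j < w -> t j <= b j) ->
  exists la mu, [/\ skew_pair la mu,
    forall j, col_height la j = if j < w then b j else 0
    & forall j, col_height mu j = if j < w then t j else 0].
Proof.
move=> ht hb tb.
have [la [pl hla]] := heights_partition hb; have [mu [pm hmu]] := heights_partition ht.
exists la, mu; split=> //; split=> // i; rewrite leqNgt; apply/negP => lt.
have := nth_col_height i (nth 0 la i) (sorted_partition pm).
have := nth_col_height i (nth 0 la i) (sorted_partition pl).
rewrite lt ltnn hla hmu; case: ifP => [/tb|_]; lia.
Qed.

Lemma filling_exists la mu (word : nat -> seq int) : skew_pair la mu ->
  (forall j, size (word j) = col_height la j - col_height mu j) ->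
  exists k : filling (skew_diagram la mu) int, forall j, col_word k j = word j.
Proof.
move=> hlm hs.
exists [ffun x => nth 0%R (word (col_of x)) (row_of x - col_height mu (col_of x))] => j.
apply: (@eq_from_nth _ 0%R); rewrite size_col_word// => d hd.
have hx : (col_height mu j + d, j) \in skew_diagram la mu by rewrite mem_diagram//; lia.
by rewrite nth_col_word// (entry_in _ _ hx) ffunE /row_of /col_of /= addKn.
Qed.

End Heights.

(** * Existence of the dual tableau *)

Section Existence.
Local Open Scope nat_scope.

Lemma realizes_step w P V G s j : link_ok w P V -> realizes w P V G s -> j.+1 < w ->
  s j.+1 < s j /\ strip_end P s j.+1 < strip_end P s j.
Proof.
move=> hL hG jw; have [a b] := realizes_strict_decr hL hG.
by split; [apply: (a (Ordinal (ltnW jw)) (Ordinal jw))|apply: (b (Ordinal (ltnW jw)) (Ordinal jw))].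
Qed.

Variables (la mu : seq nat) (k : filling (skew_diagram la mu) int).
Variable (P : nat -> seq (nat * nat)) (V : nat -> nat).
Hypotheses (hlm : skew_pair la mu).
Local Notation w := (head 0 la).
Hypothesis hP : forall j, pieces_of (col_word k j) (P j).
Hypotheses (hL : link_ok w P V) (hM : models k w P V).
Variables (G : seq (option (nat * nat))) (s : nat -> nat).
Hypothesis hG : realizes w P V G s.

(** The shift that makes the smallest first index equal to 1. *)
Lemma label_base : exists K,
  (forall j, 0 < size (P j) -> K <= s j + j) /\
  ((exists j, 0 < size (P j)) -> exists2 j, 0 < size (P j) & s j + j = K).
Proof.
have [[j0 hj0]|no] := pselect (exists j, 0 < size (P j)); last first.
  by exists 0; split.
have ex : exists K, `[< exists2 j, 0 < size (P j) & s j + j = K >].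
  by exists (s j0 + j0); apply/asboolP; exists j0.
case: (ex_minnP ex) => K /asboolP hK hmin; exists K; split=> // j hj.
by apply: hmin; apply/asboolP; exists j.
Qed.

(** First indices differ from positions in the strip by the column number, so they
    agree exactly when a piece of column j + 1 ends where a piece of column j
    begins; for connected columns this is equality of rows. *)
Lemma same_row_iff j p q : p < size (P j) -> q < size (P j.+1) ->
  s j + p = s j.+1 + q.+1 <->
  top_row (col_rows la mu j) (P j) p = bot_row (col_rows la mu j.+1) (P j.+1) q.
Proof.
move=> hp hq; have jw : j.+1 < w by apply: (col_width hlm hP hM); lia.
have pP := pos_pieces_col hP.
have [sh0|sh] := posnP (shared_rows la mu j).
  split=> [e|e]; last by have := top_bot_shared hlm hP hp hq e; rewrite sh0.
  have /eqP V0 : V j == 0 by rewrite (link_eq0 hM)// sh0.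
  have [_ _ _ /(_ j jw) h4 _] := hG; move: h4; rewrite V0 /strip_end; lia.
have hs := strip_shared hM hL hG jw.
have e1 := @strip_pos_piece _ _ _ _ _ j p hG (ltnW jw) (ltnW hp).
have e2 := @strip_pos_piece _ _ _ _ _ j.+1 q.+1 hG jw hq.
have ec := strip_pos_end hlm hM hG jw.
have inj a b : a <= size G -> b <= size G -> (strip_pos G a = strip_pos G b <-> a = b).
  move=> aG bG; split=> [e|->//]; case: (ltngtP a b) => // h.
    by have := strip_pos_lt h bG; rewrite e ltnn.
  by have := strip_pos_lt h aG; rewrite e ltnn.
have [_ h2 _ _ _] := hG; have := h2 j (ltnW jw); have := h2 j.+1 jw; rewrite /strip_end => b1 b2.
rewrite -inj; [|lia..].
have r1 := top_rowE (col_height mu j) (pP j) hp.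
have r2 := bot_rowE (col_height mu j.+1) (pP j.+1) hq.
rewrite -!(col_rows_boxes hlm hP) in r1 r2.
move: e1 e2 ec hs sh r1 r2; rewrite /shared_rows.
have := skew_heights j.+1 hlm; clear; lia.
Qed.

Lemma start_step j : j.+1 < w -> s j.+1 + j.+1 <= s j + j.
Proof. by move=> jw; have [] := realizes_step hL hG jw; lia. Qed.

Lemma start_end j : j.+1 < w -> V j = 0 -> s j + j = strip_end P s j.+1 + j.+1.
Proof. by move=> jw V0; have [_ _ _ /(_ j jw)] := hG; rewrite V0; lia. Qed.

Lemma start_mono i j : i <= j -> j < w -> s j + j <= s i + i.
Proof.
move=> /subnK <-; elim: (j - i) => // n IH; rewrite addSn => nw.
by apply: leq_trans (start_step nw) (IH _); exact: ltnW.
Qed.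

Lemma link_empty j : j.+1 < w -> size (P j) = 0 \/ size (P j.+1) = 0 -> V j = 0.
Proof. by move=> jw; have [] := hL jw; lia. Qed.

(** The index of the top piece never increases from left to right, and it exceeds all
    the indices in the next column when the two share no row. *)
Lemma labelling_exists K :
  (forall j, 0 < size (P j) -> K <= s j + j) ->
  ((exists j, 0 < size (P j)) -> exists2 j, 0 < size (P j) & s j + j = K) ->
  labelling la mu P (fun j => (s j + j).+1 - K).
Proof.
move=> K1 K2; split.
- by move=> j; rewrite (col_nonempty hlm hP) => /K1; lia.
- move=> /fset0Pn[[i j] hij].
  have [|j0 h0 e0] := K2; last by exists j0; [rewrite (col_nonempty hlm hP)|rewrite e0; lia].
  exists j; rewrite -(col_nonempty hlm hP); apply/eqP => e.
  have : i \in col_rows la mu j by rewrite col_rowsE// mem_iota; move: hij;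
    rewrite mem_diagram//; lia.
  by rewrite e.
- move=> j p q hp hq; rewrite -same_row_iff//.
  have := K1 j; have := K1 j.+1; lia.
- move=> j j' [jj ne ne' emp] dis p q hp hq.
  rewrite !(col_nonempty hlm hP) in ne ne'.
  have jw' := col_width hlm hP hM ne'.
  have key : strip_end P s j' + j' <= s j + j.
    case: j' jj ne' emp dis hq jw' => // j' jj ne' emp dis hq jw'.
    have V0 : V j' = 0.
      move: jj; rewrite ltnS leq_eqVlt => /predU1P[?|jj]; last first.
        apply: link_empty => //; left; apply/eqP;
          rewrite -leqn0 leqNgt -(col_nonempty hlm hP) emp//.
        by rewrite jj ltnSn.
      subst j'; apply/eqP; rewrite (link_eq0 hM)//; apply/eqP/eqP; rewrite -leqn0 leqNgt;
        apply/negP => sh.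
      have := dis (col_height mu j); rewrite !col_rowsE// !mem_iota.
      have := skew_heights j hlm; have := col_height_le la (leqnSn j); have :=
        col_height_le mu (leqnSn j).
      by move: sh; rewrite /shared_rows; lia.
    rewrite -start_end//; apply: start_mono; [lia|exact: ltnW].
  have := K1 j ne; have := K1 j' ne'; move: key; rewrite /strip_end; lia.
Qed.

(** Column j of the dual is laid out along the reversed strip; adding j to the
    position of its first letter turns diagonals into rows.  Positions decrease
    strictly from left to right, so these rows decrease weakly, as they must in a
    skew diagram. *)
Lemma dual_exists : exists la' mu' (k' : filling (skew_diagram la' mu') int),
  skew_pair la' mu' /\ is_dual k k'.
Proof.
have [K [K1 K2]] := label_base.
have hlab := labelling_exists K1 K2.
pose P' := dual_cols w P; pose G' := dual_strip G; pose s' := dual_starts w P G s.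
have hG' : realizes w P' (dual_links w V) G' s' := realizes_dual hG.
have hL' : link_ok w P' (dual_links w V) := dual_link_ok hL.
have fG' j : j < w -> strip_end P' s' j <= size G' by have [_ h _ _ _] := hG'; exact: h.
have step j (jw : j.+1 < w) := realizes_step hL' hG' jw.
pose t j := strip_pos G' (s' j) + j; pose b j := strip_pos G' (strip_end P' s' j) + j.
have t_dec j : j.+1 < w -> t j.+1 <= t j.
  move=> jw; have [h _] := step j jw; rewrite /t addnS -addSn leq_add2r.
  by apply: strip_pos_lt h _; apply: leq_trans (fG' j (ltnW jw)); rewrite leq_addr.
have b_dec j : j.+1 < w -> b j.+1 <= b j.
  by move=> jw; have [_ h] := step j jw;
    rewrite /b addnS -addSn leq_add2r strip_pos_lt ?fG'// ltnW.
have tb j : j < w -> b j = t j + num_boxes (P' j).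
  by move=> jw; rewrite /b /t /strip_end (strip_pos_piece hG')// take_size; lia.
have [j jw|la' [mu' [hlm' hla hmu]]] := skew_heights_exist t_dec b_dec.
  by rewrite tb// leq_addr.
have [j|k' hk'] :=
  @filling_exists la' mu' (fun j => unpieces (if j < w then P' j else [::])) hlm'.
  by rewrite hla hmu; case: ifP => // jw; rewrite tb// addKn.
have rows j : j < w -> col_rows la' mu' j = iota (t j) (num_boxes (P' j)).
  by move=> jw; rewrite col_rowsE// hla hmu jw tb// addKn.
have pP' j : pos_pieces (P' j) by apply: pos_pieces_dual; exact: pos_pieces_col.
exists la', mu', k'; split=> //; exists P, (fun j => (s j + j).+1 - K); split.
- by split.
- move=> j jw; rewrite hk'; have -> : (w.-1 - j < w) by lia.
  rewrite /P' /dual_cols subKn; last by lia.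
  by split=> //; have := pos_pieces_dual (pos_pieces_col hP j).
- by move=> c wc; rewrite col_rowsE// hla hmu ltnNge wc.
- move=> j p q hp hq e.
  have jw : j.+1 < w by apply: (col_width hlm hP hM); lia.
  have {}e : s j + q = s j.+1 + p.+1 by have := K1 j; have := K1 j.+1; lia.
  set x := w.-1 - j.+1; have x1 : x.+1 = w.-1 - j by rewrite /x; lia.
  have xw : x.+1 < w by rewrite x1; lia.
  have d1 : P' x = dual_pieces (P j.+1) by rewrite /P' /dual_cols /x subKn//; lia.
  have d2 : P' x.+1 = dual_pieces (P j) by rewrite /P' /dual_cols x1 subKn//; lia.
  have z1 : size (P' x) = size (P j.+1) by rewrite d1 size_dual_pieces.
  have z2 : size (P' x.+1) = size (P j) by rewrite d2 size_dual_pieces.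
  rewrite -x1 -d1 -d2 !rows//; last exact: ltnW.
  have b1 : (size (P j.+1)).-1 - p < size (P' x) by rewrite z1; lia.
  have b2 : (size (P j)).-1 - q < size (P' x.+1) by rewrite z2; lia.
  apply: succn_inj; rewrite top_rowE// bot_rowE//.
  have e1 := strip_pos_piece hG' (ltnW xw) (ltnW b1).
  have e2 := strip_pos_piece hG' xw b2.
  (* Both rows are the image of one boundary of the reversed strip. *)
  have : s' x + ((size (P j.+1)).-1 - p) = s' x.+1 + ((size (P j)).-1 - q).+1.
    have [_ h2 _ _ _] := hG; have := h2 j (ltnW jw); have := h2 j.+1 jw.
    rewrite /s' /dual_starts.
    have -> : w.-1 - x = j.+1 by rewrite /x; lia.
    have -> : w.-1 - x.+1 = j by rewrite x1; lia.
    by rewrite /strip_end; clear -e hp hq; lia.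
  by move=> E; rewrite E in e1; rewrite /t; clear -e1 e2; lia.
- move=> j' j [jj ne' ne emp] nocom r x.
  rewrite !(col_nonempty hlm hP) in ne ne'; have jw := col_width hlm hP hM ne.
  suff : col_height la' (w.-1 - j') <= col_height mu' (w.-1 - j).
    by rewrite !col_rowsE// !mem_iota; lia.
  case: j jj ne emp nocom jw => // j jj ne emp nocom jw.
  have jx : w.-1 - j.+1 < w.-1 - j' by lia.
  move: jj; rewrite ltnS leq_eqVlt => /predU1P[?|jj].
    subst j'; have V0 : V j = 0.
      case E : (V j) => [//|y]; have [hy _ _] := hL jw; rewrite E in hy.
      have [_ _ _ /(_ j jw)] := hG; rewrite E /strip_end => hs.
      exfalso; apply: (nocom (size (P j.+1)).-1 y) => //; first by rewrite prednK.
      have := K1 j; have := K1 j.+1; lia.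
    set a := w.-1 - j.+1; have a1 : a.+1 = w.-1 - j by rewrite /a; lia.
    have aw : a.+1 < w by rewrite a1; lia.
    rewrite -a1 hla hmu aw (ltnW aw) /b /t.
    have [_ _ _ /(_ a aw) h4 _] := hG'.
    have V'0 : dual_links w V a = 0.
      by rewrite /dual_links /a; have -> : w.-2 - (w.-1 - j.+1) = j by lia.
    rewrite V'0 addn0 in h4; rewrite addnS -addSn leq_add2r h4.
    by apply: strip_pos_lt => //; rewrite -h4; apply: leq_trans (fG' a (ltnW aw));
      rewrite leq_addr.
  have em : size (P j) = 0.
    by apply/eqP; rewrite -leqn0 leqNgt -(col_nonempty hlm hP) emp// jj ltnSn.
  have e : col_height la' (w.-1 - j) = col_height mu' (w.-1 - j).
    rewrite hla hmu; case: ifP => // h; rewrite tb// /P' /dual_cols subKn; last by lia.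
    by rewrite (size0nil em) /num_boxes addn0.
  apply: (@leq_trans (col_height la' (w.-1 - j))); first by apply: col_height_le; lia.
  by rewrite e; apply: col_height_le; lia.
Qed.

End Existence.

(** * Duality *)

Theorem theorem3p5 (R : realType) (la mu : seq nat) (hlm : skew_pair la mu)
    (k : filling (skew_diagram la mu) int) (hk : in_ID k) :
  (exists (la' mu' : seq nat) (k' : filling (skew_diagram la' mu') int),
      skew_pair la' mu' /\ is_dual k k') /\
  (forall (la' mu' : seq nat) (k' : filling (skew_diagram la' mu') int),
      skew_pair la' mu' -> is_dual k k' ->
      schur_zeta R k \is a fin_num /\ schur_zeta R k = schur_zeta R k').
Proof.
split.
  have /choice[P hP] : forall j, exists ps, pieces_of (col_word k j) ps.
    move=> j; have [_ h _] := hk; have [e|] := eqVneq (col_rows la mu j) [::]; last exact: h.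
    exists [::]; split=> //; apply: size0nil.
    rewrite size_col_word//; have := col_rowsE j hlm.
    by rewrite e => /(congr1 size); rewrite size_iota.
  have [V [hL hM]] := links_exist hlm hk hP.
  have [|G [s hG]] := @realization_exists (head 0%N la) P V _ hL.
    by move=> j _; exact: pos_pieces_col hP j.
  exact (dual_exists hlm hP hL hM hG).
move=> la' mu' k' hlm' [P [n [[hP hlab] hD hw hconn hdisc]]].
have [V [hL hM]] := links_exist hlm hk hP.
have [|G [s hG]] := @realization_exists (head 0%N la) P V _ hL.
  by move=> j _; exact: pos_pieces_col hP j.
have hM' := dual_models hlm hP hL hM hlm' hlab hD hw hconn hdisc.
rewrite (schur_zeta_det R hlm hM hL hG); split=> //.
rewrite (schur_zeta_det R hlm' hM' (dual_link_ok hL) (realizes_dual hG)).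
by rewrite (strip_det_dual R hG).
Qed.
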